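(* Let $X$ and $Y$ be nontrivial real Banach spaces. If $\sup\{\dim Z(X^{(2n}) : n\in\mathbb{N}\}=\infty$, where $X^{(2n}$ is the $2n$-th dual of $X$ and $Z(\cdot)$ denotes the centralizer, then the injective tensor product $X\widehat{\otimes}_\varepsilon Y$ has the symmetric strong diameter 2 property (SSD2P).
   Context: All Banach spaces are nontrivial (that is, nonzero) and over the real field. $B_X$ denotes the closed unit ball of a Banach space $X$, $S_X$ its unit sphere, and $X^*$ its dual. A slice of $B_X$ is a set of the form $S(B_X,x^*,\alpha)=\{x\in B_X : x^*(x)>1-\alpha\}$, where $x^*\in S_{X^*}$ and $\alpha>0$. A Banach space $X$ has the symmetric strong diameter 2 property (SSD2P) if, whenever $n\in\mathbb{N}$, $S_1,\dots,S_n$ are slices of $B_X$ and $\varepsilon>0$, there exist $x_i\in S_i$ ($i=1,\dots,n$) and $y\in B_X$, with $y$ independent of $i$, such that $x_i\pm y\in S_i$ for every $i\in\{1,\dots,n\}$ and $\|y\|>1-\varepsilon$. Let $\mathcal{L}(X)$ be the space of all bounded linear operators on $X$. A multiplier on $X$ is an element $T\in\mathcal{L}(X)$ such that every extreme point of $B_{X^*}$ is an eigenvector of the adjoint $T^*$ (the eigenvalue may be zero). For a real Banach space $X$ the centralizer $Z(X)$ is the set of all multipliers on $X$; it is a linear subspace of $\mathcal{L}(X)$, and $\dim Z(X)$ is its dimension as a real vector space. $X^{(2n}$ denotes the $2n$-th (even) dual of $X$, so the increasing sequence of even duals is $X\subset X^{**}\subset X^{(4}\subset\cdots$. $X\widehat{\otimes}_\varepsilon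 Y$ denotes the (completed) injective tensor product of $X$ and $Y$. *)

(* Defs.v *)
From HB Require Import structures.
From mathcomp Require Import all_boot all_order all_algebra.
From mathcomp Require Import all_classical all_reals all_analysis.

Set Implicit Arguments.
Unset Strict Implicit.
Unset Printing Implicit Defensive.

Import Order.TTheory GRing.Theory Num.Theory.
Import numFieldNormedType.Exports.

Local Open Scope classical_set_scope.
Local Open Scope ring_scope.

Definition unit_ball (R : realType) (V : normedModType R) : set V :=
  [set x | `|x| <= 1].

Definition unit_sphere (R : realType) (V : normedModType R) : set V :=
  [set x | `|x| = 1].

Arguments unit_ball {R} V.
Arguments unit_sphere {R} V.

Section BoundedOperators.
Variables (R : realType) (V W : normedModType R).

Definition is_blin : {pred V -> W} :=
  mem [set f : V -> W | linear f /\ continuous f].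

Record blin := Blin { blin_fun :> V -> W ; blinP : blin_fun \in is_blin }.

HB.instance Definition _ := [isSub for blin_fun].
HB.instance Definition _ := gen_eqMixin blin.
HB.instance Definition _ := gen_choiceMixin blin.

Lemma is_blin_bounded (f : V -> W) (M : R) : linear f ->
  (forall x, `|f x| <= M * `|x|) -> f \in is_blin.
Proof.
move=> fl fM; rewrite inE; split=> //.
pose fL := HB.pack_for {linear V -> W} f (GRing.isLinear.Build R V W *:%R f fl).
apply: (@bounded_linear_continuous _ _ _ fL); apply/linear_boundedP.
by near=> r => x; rewrite (le_trans (fM x))// ler_wpM2r.
Unshelve. all: by end_near. Qed.

Lemma is_blin_submod_closed : submod_closed is_blin.
Proof.
split.
  rewrite inE /=; split; last exact: cst_continuous.
  by move=> a x y; rewrite /= scaler0 addr0.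
move=> a f g /[!inE] -[fl fc] [gl gc]; split.
  move=> b x y.
  have E z : (a *: f + g) z = a *: f z + g z by [].
  by rewrite !E fl gl !scalerDr !scalerA (mulrC a b) addrACA.
move=> x; apply: (@cvgD _ _ _ _ _ (fun z => a *: f z) g); last exact: gc.
by apply: cvgZr; exact: fc.
Qed.

HB.instance Definition _ :=
  GRing.isSubmodClosed.Build _ _ is_blin is_blin_submod_closed.
HB.instance Definition _ := [SubChoice_isSubLmodule of blin by <:].

Lemma blin_linear (f : blin) : linear f.
Proof. by have := blinP f; rewrite inE => -[]. Qed.

HB.instance Definition _ (f : blin) :=
  GRing.isLinear.Build R V W *:%R f (@blin_linear f).

Lemma blin_continuous (f : blin) : continuous f.
Proof. by have := blinP f; rewrite inE => -[]. Qed.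

Definition opnorm (f : blin) : R := sup [set `|f x| | x in unit_ball V].

Lemma blin_bounded (f : blin) : exists2 M, 0 <= M &
  forall x, `|f x| <= M * `|x|.
Proof.
have /linear_bounded_continuous/linear_boundedP := @blin_continuous f.
by move=> /pinfty_ex_gt0[M M0 fM]; exists M => //; exact: ltW.
Qed.

Lemma opnorm_has_sup (f : blin) : has_sup [set `|f x| | x in unit_ball V].
Proof.
split; first by exists `|f 0|; exists 0 => //; rewrite /unit_ball/= normr0.
have [M M0 fM] := blin_bounded f; exists M => _ [x x1 <-].
by rewrite (le_trans (fM x))// -[leRHS]mulr1 ler_wpM2l.
Qed.

Lemma ler_opnorm (f : blin) x : `|f x| <= opnorm f * `|x|.
Proof.
have [->|x0] := eqVneq x 0; first by rewrite linear0 !normr0 mulr0.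
have nx0 : 0 < `|x| by rewrite normr_gt0.
rewrite -ler_pdivrMr//.
have -> : `|f x| / `|x| = `|f (`|x|^-1 *: x)|.
  by rewrite linearZ normrZ normfV normr_id mulrC.
apply: ub_le_sup; first by have [] := opnorm_has_sup f.
exists (`|x|^-1 *: x) => //.
by rewrite /unit_ball/= normrZ normfV normr_id mulVf// gt_eqF.
Qed.

Lemma opnorm_le (f : blin) M : 0 <= M ->
  (forall x, `|f x| <= M * `|x|) -> opnorm f <= M.
Proof.
move=> M0 fM; apply: ge_sup; first by have [] := opnorm_has_sup f.
by move=> _ [x x1 <-]; rewrite (le_trans (fM x))// -[leRHS]mulr1 ler_wpM2l.
Qed.

Lemma opnorm_ge0 (f : blin) : 0 <= opnorm f.
Proof.
apply: (@le_trans _ _ `|f 0|) => //; apply: ub_le_sup.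
  by have [] := opnorm_has_sup f.
by exists 0 => //; rewrite /unit_ball/= normr0.
Qed.

Lemma opnormD (f g : blin) : opnorm (f + g) <= opnorm f + opnorm g.
Proof.
apply: opnorm_le => [|x]; first by rewrite addr_ge0// opnorm_ge0.
by rewrite (le_trans (ler_normD _ _))// mulrDl lerD// ler_opnorm.
Qed.

Lemma opnormZ_le a (f : blin) : opnorm (a *: f) <= `|a| * opnorm f.
Proof.
apply: opnorm_le => [|x]; first by rewrite mulr_ge0// opnorm_ge0.
rewrite [X in `|X|](_ : _ = a *: f x)// normrZ -mulrA ler_wpM2l//.
exact: ler_opnorm.
Qed.

Lemma opnormZ a (f : blin) : opnorm (a *: f) = `|a| * opnorm f.
Proof.
apply/eqP; rewrite eq_le opnormZ_le/=.
have [->|a0] := eqVneq a 0; first by rewrite normr0 mul0r opnorm_ge0.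
rewrite -ler_pdivlMl ?normr_gt0// -normfV (le_trans _ (opnormZ_le _ _))//.
by rewrite scalerA mulVf// scale1r.
Qed.

Lemma opnorm0_eq0 (f : blin) : opnorm f = 0 -> f = 0.
Proof.
move=> f0; apply/val_inj/funext => x.
apply/eqP; rewrite -normr_le0 (le_trans (ler_opnorm f x))//.
by rewrite f0 mul0r.
Qed.

HB.instance Definition _ :=
  Lmodule_isNormed.Build R blin opnormD opnormZ opnorm0_eq0.

Lemma blin_normE (f : blin) : `|f| = sup [set `|f x| | x in unit_ball V].
Proof. by []. Qed.

Lemma blin_norm_le (f : blin) x : `|f x| <= `|f| * `|x|.
Proof. exact: ler_opnorm. Qed.

End BoundedOperators.

Section BoundedOperatorsComplete.
Variables (R : realType) (V : normedModType R) (W : completeNormedModType R).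

Lemma blin_complete (F : set_system (blin V W)) :
  ProperFilter F -> cauchy F -> cvg F.
Proof.
move=> FF /cauchyP Fc.
pose ev x := fun f : blin V W => f x.
have Fx x : cvg (ev x @ F).
  apply/cauchy_cvgP/cauchy_exP => e e0.
  have d0 : 0 < e / (1 + `|x|) by rewrite divr_gt0// ltr_pwDl.
  have [f0 Ff0] := Fc _ d0.
  exists (f0 x).
  suff : F [set f : blin V W | ball (f0 x) e (f x)] by [].
  apply: filterS Ff0 => f; rewrite /= -!ball_normE /= => fe.
  rewrite (@le_lt_trans _ _ (`|f0 - f| * `|x|))//; first exact: (blin_norm_le (f0 - f) x).
  rewrite (@le_lt_trans _ _ (`|f0 - f| * (1 + `|x|)))//.
    by rewrite ler_wpM2l// lerDr.
  by rewrite -ltr_pdivlMr// ltr_pwDl.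
pose l x := lim (ev x @ F).
have lE x : ev x @ F --> l x by exact: Fx.
have lB f0 e x : F (ball f0 e) -> `|f0 x - l x| <= e * `|x|.
  move=> Fe.
  apply: (@closed_cvg _ _ F _ (ev x)
    [set y | `|f0 x - y| <= e * `|x|]) (lE x).
    exact: closed_closed_ball_.
  apply: filterS Fe => f; rewrite -ball_normE /= => /ltW fe.
  by rewrite (le_trans (blin_norm_le (f0 - f) x))// ler_wpM2r.
have ll : linear l.
  move=> a x y; have := lE (a *: x + y).
  have -> : ev (a *: x + y) = (fun f => a *: ev x f + ev y f).
    by apply/funext => f; exact: blin_linear.
  move/cvg_unique; apply => //.
  apply: (@cvgD _ _ _ F _ (a \*: ev x) (ev y)); last exact: lE.
  by apply: cvgZl_tmp; exact: lE.
have lP : l \in @is_blin R V W.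
  have [f0 Ff0] := Fc 1 ltr01.
  apply: (@is_blin_bounded _ _ _ _ (`|f0| + 1)) => // x.
  rewrite -[l x](subrK (f0 x)) (le_trans (ler_normD _ _))// addrC mulrDl.
  by rewrite lerD ?blin_norm_le// distrC lB.
apply/cvg_ex; exists (Blin lP); apply/cvgrPdist_lt => e e0.
have e20 : 0 < e / 2 by rewrite divr_gt0.
have [f0 Ff0] := Fc _ e20; near=> f.
rewrite [e]splitr -[_ - f](subrKA f0) (le_lt_trans (ler_normD _ _))//.
rewrite ler_ltD//.
  apply: opnorm_le => [|x]; first exact: ltW.
  by rewrite distrC; exact: lB.
near: f; apply: filterS Ff0 => f.
by rewrite -ball_normE.
Unshelve. all: by end_near. Qed.

HB.instance Definition _ := Uniform_isComplete.Build (blin V W) blin_complete.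

End BoundedOperatorsComplete.

Definition dual (R : realType) (X : normedModType R) : completeNormedModType R :=
  blin X R^o.

Definition even_dual (R : realType) (X : completeNormedModType R) (n : nat) :
    completeNormedModType R :=
  iter n (fun Z : completeNormedModType R => dual (dual Z)) X.

Arguments even_dual {R} X n.

Section Composition.
Variables (R : realType) (U V W : normedModType R).

Lemma blin_comp_subproof (g : blin V W) (f : blin U V) :
  g \o f \in @is_blin R U W.
Proof.
rewrite inE; split; first by move=> a x y; rewrite /= !linearP.
by move=> x; apply: continuous_comp; exact: blin_continuous.
Qed.

Definition blin_comp (g : blin V W) (f : blin U V) : blin U W :=
  Blin (blin_comp_subproof g f).

End Composition.

Definition adjoint (R : realType) (X Y : normedModType R) (T : blin X Y) :
    dual Y -> dual X :=
  fun p => blin_comp p T.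

Definition eigenvector (R : realType) (V : lmodType R) (f : V -> V) (v : V) :=
  v != 0 /\ exists a : R, f v = a *: v.

Definition extreme_point (R : realType) (V : lmodType R) (A : set V) (p : V) :=
  A p /\ forall (x y : V) (t : R), A x -> A y -> 0 < t < 1 ->
    p = t *: x + (1 - t) *: y -> x = p /\ y = p.

Definition multiplier (R : realType) (X : normedModType R) (T : blin X X) :=
  forall p : dual X, extreme_point (unit_ball (dual X)) p ->
    eigenvector (adjoint T) p.

Definition centralizer (R : realType) (X : normedModType R) : set (blin X X) :=
  [set T | multiplier T].

Arguments centralizer {R} X.

Definition lin_indep (R : realType) (V : lmodType R) (n : nat) (v : 'I_n -> V) :=
  forall c : 'I_n -> R, \sum_(i < n) c i *: v i = 0 -> forall i, c i = 0.

(* For a linear subspace A of V, the usual dimension if it is finite and +oo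
   otherwise. *)
Definition dimension (R : realType) (V : lmodType R) (A : set V) : \bar R :=
  ereal_sup [set n%:R%:E | n in
    [set n | exists v : 'I_n -> V, (forall i, A (v i)) /\ lin_indep v]].

Definition slice (R : realType) (X : normedModType R) (p : dual X) (a : R) :
    set X :=
  [set x | unit_ball X x /\ 1 - a < p x].

Definition is_slice (R : realType) (X : normedModType R) (S : set X) :=
  exists (p : dual X) (a : R),
    [/\ unit_sphere (dual X) p, 0 < a & S = slice p a].

Definition SSD2P (R : realType) (X : normedModType R) :=
  forall (n : nat) (S : 'I_n -> set X) (e : R), (0 < n)%N ->
    (forall i, is_slice (S i)) -> 0 < e ->
  exists (x : 'I_n -> X) (y : X),
    [/\ forall i, S i (x i), unit_ball X y,
        forall i, S i (x i + y) /\ S i (x i - y) & 1 - e < `|y|].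

Section InjectiveTensor.
Variables (R : realType) (X Y : normedModType R).

(* Bounded bilinear forms on X^* x Y^*, in curried form: the operator norm is
   the supremum of |B p q| over the two unit balls. *)
Definition dual_bilin : completeNormedModType R :=
  blin (dual X) (dual (dual Y)).

Lemma eval_subproof (y : Y) : (fun q : dual Y => q y : R^o) \in
  @is_blin R (dual Y) R^o.
Proof.
apply: (@is_blin_bounded _ _ _ _ `|y|) => // q.
by rewrite mulrC; exact: (blin_norm_le q y).
Qed.

Definition eval (y : Y) : dual (dual Y) := Blin (eval_subproof y).

Lemma eval_norm_le y : `|eval y| <= `|y|.
Proof. by apply: opnorm_le => // q; rewrite mulrC; exact: (blin_norm_le q y). Qed.

Lemma elem_tensor_subproof (x : X) (y : Y) :
  (fun p : dual X => (p x : R) *: eval y) \in @is_blin R (dual X) (dual (dual Y)).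
Proof.
apply: (@is_blin_bounded _ _ _ _ (`|x| * `|eval y|)) => [a p q|p].
  by rewrite scalerA -scalerDl.
rewrite normrZ mulrAC ler_wpM2r// mulrC; exact: (blin_norm_le p x).
Qed.

Definition elem_tensor (x : X) (y : Y) : dual_bilin :=
  Blin (elem_tensor_subproof x y).

Lemma elem_tensorE x y p q : elem_tensor x y p q = p x * q y.
Proof. by []. Qed.

(* Since X^* and Y^* separate the points of X and Y, this is a copy of the
   algebraic tensor product of X and Y. *)
Definition alg_tensor : set dual_bilin :=
  [set u | exists s : seq (X * Y), u = \sum_(z <- s) elem_tensor z.1 z.2].

Lemma alg_tensor_normE (s : seq (X * Y)) :
  `|\sum_(z <- s) elem_tensor z.1 z.2| =
  sup [set `|\sum_(z <- s) pq.1 z.1 * pq.2 z.2| | pq in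
        [set pq : dual X * dual Y | unit_ball (dual X) pq.1 /\
                                    unit_ball (dual Y) pq.2]].
Proof.
set u := \sum_(z <- s) _; set A := [set _ | _ in _].
have uE p q : u p q = \sum_(z <- s) p z.1 * q z.2.
  rewrite /u; elim: s {u A} => [|z s IH]; first by rewrite !big_nil.
  by rewrite !big_cons -IH.
have A0 : A !=set0.
  by exists `|u 0 0|, (0, 0); rewrite ?uE// /unit_ball/= !normr0.
have ubA : ubound A `|u|.
  move=> _ [[p q] /= [p1 q1] <-]; rewrite -uE.
  rewrite (le_trans (blin_norm_le (u p) q))//.
  rewrite (@le_trans _ _ `|u p|) ?ler_piMr//.
  by rewrite (le_trans (blin_norm_le u p))// ler_piMr.
apply/eqP; rewrite eq_le; apply/andP; split; last exact: ge_sup.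
apply: ge_sup; first by have [] := opnorm_has_sup u.
move=> _ [p p1 <-]; apply: ge_sup; first by have [] := opnorm_has_sup (u p).
move=> _ [q q1 <-]; apply: ub_le_sup; first by exists `|u|.
by exists (p, q) => //=; rewrite uE.
Qed.

Definition is_inj_tensor : {pred dual_bilin} := mem (closure alg_tensor).

Record inj_tensor :=
  InjTensor { inj_tensor_val :> dual_bilin ;
              inj_tensorP : inj_tensor_val \in is_inj_tensor }.

HB.instance Definition _ := [isSub for inj_tensor_val].
HB.instance Definition _ := gen_eqMixin inj_tensor.
HB.instance Definition _ := gen_choiceMixin inj_tensor.

Lemma alg_tensor_lin a u v : alg_tensor u -> alg_tensor v ->
  alg_tensor (a *: u + v).
Proof.
move=> [s ->] [t ->]; exists ([seq (a *: z.1, z.2) | z <- s] ++ t).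
rewrite big_cat big_map scaler_sumr; congr (_ + _); apply: eq_bigr => z _.
apply/val_inj/funext => p; apply/val_inj/funext => q /=.
have pZ : p (a *: z.1) = a * p z.1 :> R by exact: linearZ.
suff : a * (p z.1 * q z.2) = p (a *: z.1) * q z.2 :> R by [].
by rewrite pZ mulrA.
Qed.

Lemma is_inj_tensor_submod_closed : submod_closed is_inj_tensor.
Proof.
split.
  by rewrite inE; apply: subset_closure; exists [::]; rewrite big_nil.
move=> a u v /[!inE] cu cv B nB.
have : nbhs (u, v) [set uv | B (a *: uv.1 + uv.2)].
  have c : continuous (fun uv : dual_bilin * dual_bilin => a *: uv.1 + uv.2).
    move=> uv; apply: cvgD; last exact: cvg_snd.
    by apply: cvgZl_tmp; exact: cvg_fst.
  exact: (c (u, v)).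
move=> [[C D]/= [nC nD] CD].
have [u' [tu' Cu']] := cu _ nC; have [v' [tv' Dv']] := cv _ nD.
exists (a *: u' + v'); split; first exact: alg_tensor_lin.
exact: (CD (u', v')).
Qed.

HB.instance Definition _ :=
  GRing.isSubmodClosed.Build _ _ is_inj_tensor is_inj_tensor_submod_closed.
HB.instance Definition _ := [SubChoice_isSubLmodule of inj_tensor by <:].

Definition inj_norm (u : inj_tensor) : R := `|inj_tensor_val u|.

Lemma inj_normD u v : inj_norm (u + v) <= inj_norm u + inj_norm v.
Proof. exact: ler_normD. Qed.

Lemma inj_normZ a u : inj_norm (a *: u) = `|a| * inj_norm u.
Proof. exact: normrZ. Qed.

Lemma inj_norm0_eq0 u : inj_norm u = 0 -> u = 0.
Proof. by move/normr0_eq0 => u0; exact: val_inj. Qed.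

HB.instance Definition _ :=
  Lmodule_isNormed.Build R inj_tensor inj_normD inj_normZ inj_norm0_eq0.

Lemma inj_tensor_complete (F : set_system inj_tensor) :
  ProperFilter F -> cauchy F -> cvg F.
Proof.
move=> FF /cauchyP Fc.
have : cvg (inj_tensor_val @ F).
  apply/cauchy_cvgP/cauchy_exP => e e0; have [u Fu] := Fc _ e0.
  exists (inj_tensor_val u).
  suff : F [set v : inj_tensor | ball (inj_tensor_val u) e (inj_tensor_val v)].
    by [].
  by apply: filterS Fu => v; rewrite /= -!ball_normE.
move/cvg_ex => [l Fl].
have lP : l \in is_inj_tensor.
  rewrite inE; apply: (@closed_cvg _ _ F _ inj_tensor_val
    (closure alg_tensor) (@closed_closure _ alg_tensor) _ l Fl).
  by near=> u; have := inj_tensorP u; rewrite inE.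
apply/cvg_ex; exists (InjTensor lP); apply/cvgrPdist_lt => e e0.
by move/cvgrPdist_lt : Fl => /(_ e e0).
Unshelve. all: by end_near. Qed.

HB.instance Definition _ := Uniform_isComplete.Build inj_tensor inj_tensor_complete.

End InjectiveTensor.

(* Main.v *)
(** Multipliers act diagonally on the extreme points of the dual ball. If a
    Banach space [Z] has many linearly independent multipliers, polynomials in
    them yield many operators [f_k] on [Z] whose eigenvalues lie in [[0, 1]],
    peak at 1 and are nearly disjoint. Then [u - f_k u + f_k z_k (x) y0] and
    [u - f_k u - f_k z_k (x) y0] stay in the unit ball of the injective tensor
    product for [u] in that ball, whereas any functional of norm 1 is small on
    [f_k u] and on [f_k z_k (x) y0] for all but few [k]; so a fixed number of
    slices can be perturbed by a common vector. The norms are computed with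
    extreme points that attain them, which Zorn's lemma provides. A finite
    system of norm inequalities and functional values that is solvable in
    [Z^**] is approximately solvable in [Z], so the perturbation descends one
    bidual at a time from the even duals to [X]. *)

From HB Require Import structures.
Require Import Defs.
From mathcomp Require Import all_boot all_order all_algebra.
From mathcomp Require Import all_classical all_reals all_analysis.
From mathcomp Require Import ring lra.

Set Implicit Arguments.
Unset Strict Implicit.
Unset Printing Implicit Defensive.

Import Order.TTheory GRing.Theory Num.Theory.
Import numFieldNormedType.Exports.

Local Open Scope classical_set_scope.
Local Open Scope ring_scope.

(** * Norming extreme points *)

Section Sublinear.
Context {R : realType} {V : lmodType R}.
Implicit Types (q p : V -> R) (x y : V).

Definition sublinear q :=
  (forall x y, q (x + y) <= q x + q y) /\
  (forall a x, 0 < a -> q (a *: x) <= a * q x).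

Definition dominated p q := forall x, p x <= q x.

(* Since a sublinear functional is the supremum of the linear functionals it
   dominates, [face q0 q] says that the linear functionals dominated by [q]
   form a face of the convex set of those dominated by [q0]. *)
Definition face q0 q :=
  forall p1 p2 t, linear (p1 : V -> R^o) -> linear (p2 : V -> R^o) ->
    dominated p1 q0 -> dominated p2 q0 -> 0 < t < 1 ->
    dominated (fun x => t * p1 x + (1 - t) * p2 x) q ->
    dominated p1 q /\ dominated p2 q.

(* The functional whose dominated linear functionals are the linear [p]
   dominated by [q] with [p x = q x]. *)
Definition support_at q x y :=
  inf [set q (y + t *: x) - t * q x | t in [set t | 0 <= t]].

Lemma sublinear0 q : sublinear q -> q 0 = 0.
Proof.
move=> [_ qZ]; have := qZ 2 0; have := qZ 2^-1 0; rewrite !scaler0.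
by move=> /(_ ltac:(lra)) ? /(_ ltac:(lra)) ?; lra.
Qed.

Lemma sublinearZ q a x : sublinear q -> 0 <= a -> q (a *: x) = a * q x.
Proof.
move=> sq; rewrite le_eqVlt => /predU1P[<-|a0].
  by rewrite scale0r mul0r sublinear0.
have [_ qZ] := sq; apply/eqP; rewrite eq_le qZ//=.
have /(qZ _ (a *: x)) : 0 < a^-1 by rewrite invr_gt0.
by rewrite scalerA mulVf ?gt_eqF// scale1r ler_pdivlMl.
Qed.

Lemma support_at_lb q x y t : sublinear q -> 0 <= t ->
  - q (- y) <= q (y + t *: x) - t * q x.
Proof.
move=> sq t0; have [qD _] := sq.
have := qD (y + t *: x) (- y); rewrite addrAC subrr add0r sublinearZ//; lra.
Qed.

Lemma support_at_le q x y t : sublinear q -> 0 <= t ->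
  support_at q x y <= q (y + t *: x) - t * q x.
Proof.
move=> sq t0; apply: ge_inf; last by exists t.
by exists (- q (- y)) => _ [s s0 <-]; exact: support_at_lb.
Qed.

Lemma support_at_ge q x y c :
  (forall t, 0 <= t -> c <= q (y + t *: x) - t * q x) -> c <= support_at q x y.
Proof.
move=> h; apply: lb_le_inf; first by exists (q (y + 0 *: x) - 0 * q x), 0 => /=.
by move=> _ [t t0 <-]; exact: h.
Qed.

Lemma support_at_dominated q x : sublinear q -> dominated (support_at q x) q.
Proof.
by move=> sq y; have := @support_at_le q x y 0 sq (lexx 0);
  rewrite scale0r addr0 mul0r subr0.
Qed.

Lemma support_at_sublinear q x : sublinear q -> sublinear (support_at q x).
Proof.
move=> sq; have [qD qZ] := sq; split=> [y z|a y a0].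
  rewrite -lerBlDr; apply: support_at_ge => t t0.
  rewrite lerBlDr -lerBlDl; apply: support_at_ge => s s0.
  have := @support_at_le q x (y + z) (t + s) sq (addr_ge0 t0 s0).
  by have := qD (y + t *: x) (z + s *: x); rewrite addrACA -scalerDl; lra.
rewrite -ler_pdivrMl//; apply: support_at_ge => t t0.
rewrite ler_pdivrMl//.
have := @support_at_le q x (a *: y) (a * t) sq (mulr_ge0 (ltW a0) t0).
have := qZ a (y + t *: x) a0.
by rewrite scalerDr scalerA => h1 h2; rewrite mulrBr; lra.
Qed.

Lemma support_at_opp q x : sublinear q -> support_at q x (- x) <= - q x.
Proof.
move=> sq; have := @support_at_le q x (- x) 1 sq ler01.
by rewrite scale1r addNr sublinear0// mul1r add0r.
Qed.

Lemma linear_formE p : linear (p : V -> R^o) ->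
  [/\ forall x, p (- x) = - p x, forall x y, p (x + y) = p x + p y &
      forall a x, p (a *: x) = a * p x].
Proof.
move=> lp; pose pL := HB.pack_for {linear V -> R^o} p
  (GRing.isLinear.Build R V R^o *:%R p lp).
by split=> [||a x]; [exact: (linearN pL)|exact: (linearD pL)|exact: (linearZZ pL)].
Qed.

(** A convex combination of functionals below [q] that attains [q x] forces each of them to attain
    [q x], as none can exceed it. *)
Lemma support_at_face q0 q x : sublinear q -> dominated q q0 -> face q0 q ->
  face q0 (support_at q x).
Proof.
move=> sq qq0 fq p1 p2 t l1 l2 p1q0 p2q0 t01 pq.
have [p1q p2q] : dominated p1 q /\ dominated p2 q.
  apply: (fq p1 p2 t) => // y.
  exact: le_trans (pq y) (support_at_dominated _ sq y).
have lin (p : V -> R) : linear (p : V -> R^o) ->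
    p (- x) = - p x /\ forall y s, p (y + s *: x) = p y + s * p x.
  by move=> /linear_formE[pN pD pZ]; split=> // y s; rewrite pD pZ.
have [p1N p1D] := lin _ l1; have [p2N p2D] := lin _ l2.
have [p1x p2x] : p1 x = q x /\ p2 x = q x.
  have := pq (- x); rewrite p1N p2N => /le_trans/(_ (support_at_opp _ sq)) h.
  have := p1q x; have := p2q x; case/andP: t01 => t0 t1; split; nra.
split=> y; apply: support_at_ge => s s0.
- by rewrite lerBrDr -{1}p1x -p1D; exact: p1q.
- by rewrite lerBrDr -{1}p2x -p2D; exact: p2q.
Qed.

(** The pointwise infimum works. For subadditivity, two members used at [x] and at [y] are both
    replaced by the smaller one, which is where the chain condition enters. *)
Lemma sublinear_chain_inf (A : set (V -> R)) q1 : sublinear q1 ->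
  (exists q, A q) -> (forall q, A q -> sublinear q /\ dominated q q1) ->
  (forall q q', A q -> A q' -> dominated q q' \/ dominated q' q) ->
  exists2 q, sublinear q & (forall q', A q' -> dominated q q') /\
    forall y c, (forall q', A q' -> c <= q' y) -> c <= q y.
Proof.
move=> sq1 [qA AqA] Asub Achain.
pose q y := inf [set q' y | q' in A].
have q_le q' y : A q' -> q y <= q' y.
  move=> Aq'; apply: ge_inf; last by exists q'.
  exists (- q1 (- y)) => _ [p Ap <-].
  have [[pD pZ] pq1] := Asub _ Ap; have := pD y (- y).
  by rewrite subrr (sublinear0 (conj pD pZ)); have := pq1 (- y); lra.
have q_ge y c : (forall q', A q' -> c <= q' y) -> c <= q y.
  by move=> h; apply: lb_le_inf => [|_ [q' Aq' <-]]; [exists (qA y), qA|exact: h].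
exists q; last by split=> // q' Aq' y; exact: q_le.
split=> [x y|a x a0]; last first.
  rewrite -ler_pdivrMl//; apply: q_ge => q' Aq'; rewrite ler_pdivrMl//.
  have [[_ q'Z] _] := Asub _ Aq'.
  exact: le_trans (q_le _ _ Aq') (q'Z _ _ a0).
rewrite -lerBlDr; apply: (q_ge) => p Ap.
rewrite lerBlDr -lerBlDl; apply: q_ge => p' Ap'; rewrite lerBlDl.
case: (Achain _ _ Ap Ap') => [pp'|p'p].
- have [[pD _] _] := Asub _ Ap.
  by have := q_le _ (x + y) Ap; have := pD x y; have := pp' y; lra.
- have [[pD _] _] := Asub _ Ap'.
  by have := q_le _ (x + y) Ap'; have := pD x y; have := p'p x; lra.
Qed.

(** Hahn--Banach and Krein--Milman in one: a minimal sublinear functional defining a face cannot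
    shrink under [support_at], and this makes it linear. *)
Lemma minimal_face q0 q1 : sublinear q1 -> dominated q1 q0 -> face q0 q1 ->
  exists p, [/\ linear (p : V -> R^o), dominated p q1 & face q0 p].
Proof.
move=> sq1 q10 f1.
pose P q := [/\ sublinear q, dominated q q1 & face q0 q].
pose T := {q | P q}.
(* The order is reversed, so that a maximal element is a minimal functional. *)
pose Rel (s t : T) : bool := `[< dominated (sval t) (sval s) >].
have [||||m mmin] := @Zorn T Rel.
- by move=> t; apply/asboolP => x.
- move=> r s t /asboolP rs /asboolP st; apply/asboolP => x.
  exact: le_trans (st x) (rs x).
- move=> s t /asboolP ts /asboolP st.
  apply: eq_sig_hprop => [q|]; first exact: Prop_irrelevance.
  by apply/funext => x; apply/eqP; rewrite eq_le st ts.
- move=> A totA; have [[s As]|A0] := pselect (exists s, A s); last first.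
    exists (exist P q1 (And3 sq1 (fun x => lexx _) f1)) => s As.
    by case: A0; exists s.
  pose B := [set sval t | t in A].
  have [|||q sq [qB Bq]] := @sublinear_chain_inf B q1 sq1.
  + by exists (sval s), s.
  + by move=> _ [t At <-]; have [] := svalP t.
  + move=> _ _ [t At <-] [u Au <-].
    by case: (totA _ _ At Au) => /asboolP; [right|left].
  have Pq : P q.
    split=> //.
      move=> x; have [_ sq1' _] := svalP s; apply: le_trans (sq1' x).
      by apply: qB; exists s.
    move=> p1 p2 t l1 l2 p1q p2q t01 pq.
    have h u : A u -> dominated p1 (sval u) /\ dominated p2 (sval u).
      move=> Au; have [_ _ fu] := svalP u; apply: (fu _ _ t) => // y.
      by apply: le_trans (pq y) _; apply: qB; exists u.
    by split=> y; apply: Bq => _ [u Au <-]; have [] := h u Au.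
  exists (exist P q Pq) => t At; apply/asboolP => /=.
  by apply: qB; exists t.
have [sm mq1 fm] := svalP m.
have mq0 : dominated (sval m) q0.
  by move=> x; exact: le_trans (mq1 x) (q10 x).
exists (sval m); split=> //.
(* Minimality forces [m = support_at m x], whence [m (- x) <= - m x]. *)
have mN x : sval m (- x) = - sval m x.
  have Ps : P (support_at (sval m) x).
    split; first exact: support_at_sublinear.
      by move=> y; apply: le_trans (mq1 y); exact: support_at_dominated.
    exact: support_at_face.
  have /(congr1 sval)/= e := mmin (exist P _ Ps)
    (asboolT (support_at_dominated _ sm)).
  apply/eqP; rewrite eq_le -{1}e support_at_opp//=.
  by have [mD _] := sm; have := mD x (- x); rewrite subrr sublinear0//; lra.
have mD x y : sval m (x + y) = sval m x + sval m y.
  have [D _] := sm; apply/eqP; rewrite eq_le D/=.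
  by have := D (x + y) (- y); rewrite addrK mN; lra.
move=> a x y; rewrite mD; congr (_ + _).
have [a0|a0] := leP 0 a; first by rewrite sublinearZ.
by rewrite -[a]opprK scaleNr mN sublinearZ ?oppr_ge0 ?ltW// scaleNr.
Qed.

(** Starting the minimisation at [support_at q x] makes the resulting linear functional attain
    [q x]. *)
Lemma extreme_dominated q x : sublinear q ->
  exists p, [/\ linear (p : V -> R^o), dominated p q, p x = q x & face q p].
Proof.
move=> sq; have fq : face q q by [].
have [p [lp pq fp]] := @minimal_face q (support_at q x)
  (support_at_sublinear x sq) (support_at_dominated x sq)
  (support_at_face (x := x) sq (fun y => lexx _) fq).
have pq' y : p y <= q y by apply: le_trans (pq y) _; exact: support_at_dominated.
exists p; split=> //; apply/eqP; rewrite eq_le pq'/=.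
have := le_trans (pq (- x)) (support_at_opp x sq).
by have [-> _ _] := linear_formE lp; rewrite lerN2.
Qed.

End Sublinear.

(** * Extreme points of the dual unit ball *)

Section DualExtreme.
Context {R : realType} {X : normedModType R}.

Lemma norm_sublinear : sublinear (fun x : X => `|x|).
Proof.
split=> [x y|a x a0]; first exact: ler_normD.
by rewrite normrZ gtr0_norm.
Qed.

Lemma unit_ball_dualP (p : dual X) :
  unit_ball (dual X) p <-> dominated (p : X -> R) (fun x => `|x|).
Proof.
split=> [p1 x|h].
  apply: le_trans (ler_norm _) _; apply: le_trans (blin_norm_le p x) _.
  by rewrite ler_piMl.
apply: opnorm_le => // x; rewrite mul1r; have := h x; have := h (- x).
by rewrite linearN normrN ler_norml => h1 ->; rewrite andbT lerNl.
Qed.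

(** Here [q] is the norm. A linear functional dominated by the linear [p] equals [p], so the face
    defined by [p] is a single point, that is, [p] is extreme. *)
Lemma extreme_norming (x : X) : exists p : dual X,
  extreme_point (unit_ball (dual X)) p /\ p x = `|x|.
Proof.
have [p [lp pq px fp]] := extreme_dominated x norm_sublinear.
have bp : (p : X -> R^o) \in @is_blin R X R^o.
  apply: (@is_blin_bounded _ _ _ _ 1) => // y; rewrite mul1r.
  have [pN _ _] := linear_formE lp.
  have := pq y; have := pq (- y); rewrite pN normrN ler_norml => h1 h2.
  by rewrite h2 andbT lerNl.
exists (Blin bp); split=> //; split; first exact/unit_ball_dualP.
move=> p1 p2 t /unit_ball_dualP p1b /unit_ball_dualP p2b t01 pE.
have pEx y : p y = t * p1 y + (1 - t) * p2 y.
  by have /(congr1 (fun f : dual X => f y : R)) := pE.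
have [h1 h2] := fp p1 p2 t (@blin_linear _ _ _ p1) (@blin_linear _ _ _ p2)
  p1b p2b t01 (fun y => eq_ind _ (fun z => z <= p y) (lexx _) _ (pEx y)).
have eqp (p' : dual X) : dominated (p' : X -> R) p -> p' = Blin bp.
  move=> p'p; apply/val_inj/funext => y; apply/eqP; rewrite eq_le p'p/=.
  have := p'p (- y); rewrite linearN.
  by have [-> _ _] := linear_formE lp; rewrite lerN2.
by split; exact: eqp.
Qed.

Lemma dual_norming (x : X) : exists2 p : dual X,
  unit_ball (dual X) p & p x = `|x|.
Proof. by have [p [[p1 _] px]] := extreme_norming x; exists p. Qed.

End DualExtreme.

(** * Approximation from the bidual *)

(** The functional is the distance to the range of [D] measured by [N]. *)
Lemma sublinear_quotient (R : realType) (U V : lmodType R)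
    (N : V -> R) (D : {linear U -> V}) : sublinear N -> (forall v, 0 <= N v) ->
  exists q : V -> R, [/\ sublinear q, forall v x, q v <= N (v - D x) &
    forall v c, q v < c -> exists x, N (v - D x) < c].
Proof.
move=> sN N0; have [ND NZ] := sN.
pose S v := [set N (v - D x) | x in [set: U]].
have Slb v : has_lbound (S v) by exists 0 => _ [x _ <-].
have Sinf v : has_inf (S v) by split => //; exists (N (v - D 0)), 0.
pose q v := inf (S v).
have q_le v x : q v <= N (v - D x) by apply: ge_inf => //; exists x.
have q_lt v c : q v < c -> exists x, N (v - D x) < c.
  rewrite -subr_gt0 => /inf_adherent -/(_ _ (Sinf v))[_ [x _ <-]].
  by rewrite -/(q v) addrCA subrr addr0 => h; exists x.
have q_ge v c : (forall x, c <= N (v - D x)) -> c <= q v.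
  move=> h; apply: lb_le_inf; first by have [] := Sinf v.
  by move=> _ [x _ <-].
exists q; split=> //; split=> [u v|a v a0].
  rewrite -lerBlDr; apply: (q_ge) => x; rewrite lerBlDr -lerBlDl; apply: q_ge => y.
  rewrite lerBlDl; apply: le_trans (q_le _ (x + y)) _.
  by rewrite linearD opprD addrACA; exact: ND.
rewrite -ler_pdivrMl//; apply: q_ge => x; rewrite ler_pdivrMl//.
apply: le_trans (q_le _ (a *: x)) _.
by rewrite linearZ -scalerBr; exact: NZ.
Qed.

(** Coordinates are rounded down to multiples of [d]; there are finitely many codes, and two members
    of [A] with the same code differ by at most [d]. *)
Lemma bounded_net (R : realType) (T : finType) (A : set (T -> R)) (B d : R) :
  (forall a t, A a -> `|a t| <= B) -> 0 < d ->
  exists (K : finType) (c : K -> T -> R),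
    (forall k, c k = 0 \/ A (c k)) /\
    forall a, A a -> exists k, forall t, `|a t - c k t| <= d.
Proof.
move=> AB d0.
pose M := Num.truncn (2 * B / d).
pose code (a : T -> R) : {ffun T -> 'I_M.+1} :=
  [ffun t => inord (Num.truncn ((a t + B) / d))].
have codeE a t : A a -> (code a t)%:R <= (a t + B) / d < (code a t).+1%:R.
  move=> Aa; have := AB a t Aa; rewrite ler_norml => /andP[aB aB'].
  have a0 : 0 <= (a t + B) / d by apply: divr_ge0; lra.
  rewrite ffunE inordK; first exact: truncn_itv.
  rewrite ltnS; apply: le_truncn; rewrite ler_pM2r ?invr_gt0//. lra.
(* Representatives are taken in [A] itself, so that bounds valid on [A] hold for them; codes that do
   not occur get 0. *)
pose rep k : T -> R := if pselect (exists2 a, A a & code a = k) is left h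
  then projT1 (cid2 h) else 0.
exists {ffun T -> 'I_M.+1}, rep; split=> [k|a Aa].
  by rewrite /rep; case: pselect => [h|_]; [right; case: (cid2 h)|left].
exists (code a) => t; rewrite /rep; case: pselect => [h|[]]; last by exists a.
case: (cid2 h) => /= b Ab cb.
have := codeE a t Aa; have := codeE b t Ab; rewrite cb.
set m := nat_of_ord _; rewrite -!natr1 !ler_pdivlMr// !ltr_pdivrMr// !mulrDl mul1r.
by move=> /andP[? ?] /andP[? ?]; rewrite ler_norml; apply/andP; split; lra.
Qed.

Lemma blin_sumE (R : realType) (V W : normedModType R) (I : finType)
    (f : I -> blin V W) (x : V) : (\sum_i f i) x = \sum_i f i x.
Proof. exact: (big_morph (fun g : blin V W => g x) (fun _ _ => erefl) erefl). Qed.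

Lemma blin_combE (R : realType) (V W : normedModType R) (I : finType)
    (a : I -> R) (f : I -> blin V W) (x : V) :
  (\sum_i a i *: f i) x = \sum_i a i *: f i x.
Proof. exact: blin_sumE. Qed.

Lemma dual_almost_norming (R : realType) (X : normedModType R) (p : dual X) e :
  0 < e -> exists2 x : X, `|x| <= 1 & `|p| - e < p x.
Proof.
move=> e0; have [_ [x x1 <-]] := sup_adherent e0 (opnorm_has_sup p).
rewrite /unit_ball /= in x1; rewrite -[sup _]/(`|p|) => h.
have [p0|p0] := leP 0 (p x : R); first by exists x; rewrite // -[ltRHS]ger0_norm.
by exists (- x); rewrite ?normrN// linearN -[ltRHS]ltr0_norm.
Qed.

(* Hahn--Banach on [X^K * R^L]: a functional vanishing on the image of [X^T]
   under the system also vanishes on the image of the bidual of [X^T] under the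
   bidual system. *)
Lemma goldstine_system (R : realType) (X : normedModType R) (K T L : finType)
    (c : K -> T -> R) (G : L -> T -> dual X) (F : T -> dual (dual X)) (eta : R) :
  (forall k, `|\sum_t c k t *: F t| <= 1) -> 0 < eta ->
  exists x : T -> X, (forall k, `|\sum_t c k t *: x t| <= 1 + eta) /\
    forall l, `|\sum_t (G l t (x t) : R) - \sum_t (F t (G l t) : R)| <= eta.
Proof.
move=> F1 eta0.
pose V := ((K -> X) * (L -> R^o))%type.
(* With this weight [d * s <= 1 + eta] means [s <= eta], so the single inequality [N < 1 + eta]
   yields both conclusions. *)
pose d := (1 + eta) / eta.
have d0 : 0 < d by rewrite divr_gt0//; lra.
pose m (w : K -> X) : R := \big[Num.max/0]_k `|w k|.
have m0 w : 0 <= m w by exact: bigmax_ge_id.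
have m_le w k : `|w k| <= m w by exact: le_bigmax.
pose N (v : V) : R := m v.1 + d * \sum_l `|v.2 l|.
have N0 v : 0 <= N v.
  by apply: addr_ge0 => //; apply: mulr_ge0; [exact: ltW|exact: sumr_ge0].
have sN : sublinear N.
  split=> [u v|a v a0]; last first.
    rewrite /N mulrDr lerD//.
      apply: bigmax_le => [|k _]; first exact: mulr_ge0 (ltW a0) (m0 _).
      by rewrite normrZ gtr0_norm// ler_pM2l.
    rewrite mulrCA ler_pM2l// mulr_sumr; apply: ler_sum => l _.
    by rewrite normrM gtr0_norm.
  rewrite /N addrACA lerD//.
    apply: bigmax_le => [|k _]; first by rewrite addr_ge0.
    by rewrite (le_trans (ler_normD _ _))// lerD.
  rewrite -mulrDr ler_pM2l// -big_split/=; apply: ler_sum => l _.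
  exact: ler_normD.
pose D (x : T -> X) : V :=
  (fun k => \sum_t c k t *: x t, fun l => \sum_t (G l t (x t) : R)).
have lD : linear D.
  move=> a x y; congr pair; apply/funext => i /=; rewrite !fctE.
    rewrite scaler_sumr -big_split/=; apply: eq_bigr => t _.
    by rewrite scalerDr !scalerA mulrC.
  rewrite scaler_sumr -big_split/=; apply: eq_bigr => t _.
  exact: linearP.
pose DL := HB.pack_for {linear (T -> X) -> V} D
  (GRing.isLinear.Build R (T -> X) V *:%R D lD).
have [q [sq qN qlt]] := sublinear_quotient DL sN N0.
pose b : L -> R := fun l => \sum_t (F t (G l t) : R).
have [lam [llam lamq lamb _]] := extreme_dominated ((0, b) : V) sq.
have [lamN lamD lamZ] := linear_formE llam.
(* [q (0, b)] is the distance of the target values from the range of [D]; if it is at most 1, a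
   near-minimiser solves the system. The bound is proved for [lam (0, b)], which has the same
   value. *)
suff : q (0, b) <= 1.
  move=> q1; have /qlt[x] : q (0, b) < 1 + eta by lra.
  rewrite /N /=; set s := \sum_l _ => Nx.
  have s0 : 0 <= s by exact: sumr_ge0.
  exists x; split=> [k|l].
    have := m_le (0 - fun k => \sum_t c k t *: x t) k.
    rewrite [X in `|X|]sub0r normrN => /le_trans; apply.
    have : 0 <= d * s by rewrite mulr_ge0// ltW.
    by move: Nx; lra.
  have sl : `|b l - \sum_t (G l t (x t) : R)| <= s.
    by rewrite /s (bigD1 l)//= lerDl sumr_ge0.
  rewrite distrC (le_trans sl)//.
  have : d * s <= 1 + eta by have := m0 (0 - fun k => \sum_t c k t *: x t); lra.
  by rewrite /d mulrAC ler_pdivrMr// ler_pM2l//; lra.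
have lamD0 x : lam (D x) = 0.
  have DN : D (- x) = - D x by exact: (linearN DL).
  have qD y : q (D y) <= 0.
    apply: le_trans (qN _ y) _; rewrite subrr /N/= big1 ?mulr0 ?addr0.
      by apply: bigmax_le => // k _; rewrite normr0.
    by move=> l _; rewrite normr0.
  apply/eqP; rewrite eq_le (le_trans (lamq _) (qD x))/=.
  by have := le_trans (lamq _) (qD (- x)); rewrite DN lamN oppr_le0.
have lamN' v : lam v <= N v.
  apply: le_trans (lamq v) _; have := qN v 0.
  by rewrite [DL 0]linear0 subr0.
pose e (k : K) (z : X) : V := (fun k' => if k' == k then z else 0, 0).
have e_lin k : linear (e k).
  move=> a y z; congr pair; last by rewrite /= scaler0 addr0.
  by apply/funext => k'; rewrite /= !fctE; case: eqP => // _; rewrite scaler0 addr0.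
have eN k z : N (e k z) <= `|z|.
  rewrite /N /= [X in d * X]big1 => [|l _]; last by rewrite normr0.
  rewrite mulr0 addr0; apply: bigmax_le => // k' _.
  by case: eqP => // _; rewrite normr0.
have fP k : (fun z => lam (e k z) : R^o) \in @is_blin R X R^o.
  apply: (@is_blin_bounded _ _ _ _ 1) => [a y z|z].
    by rewrite e_lin lamD lamZ.
  rewrite mul1r ler_norml; apply/andP; split; last exact: le_trans (lamN' _) (eN _ _).
  rewrite lerNl -lamN.
  have -> : - e k z = e k (- z).
    by have := e_lin k (-1) z 0; rewrite addr0 !scaleN1r => ->;
      rewrite [e k 0](_ : _ = 0) ?addr0//; congr pair; apply/funext => k' /=; case: eqP.
  by apply: le_trans (lamN' _) _; rewrite -[leRHS]normrN.
pose f k : dual X := Blin (fP k).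
pose u (l : L) : V := (0, fun l' => (l' == l)%:R).
have lamE (w : K -> X) (v : L -> R^o) :
    lam (w, v) = \sum_k (f k (w k) : R) + \sum_l v l * lam (u l).
  have -> : (w, v) = \sum_k e k (w k) + \sum_l v l *: u l.
    have fst_sum (I : finType) (g : I -> V) : (\sum_i g i).1 = \sum_i (g i).1.
      exact: (big_morph (fun z : V => z.1) (fun _ _ => erefl) erefl).
    have snd_sum (I : finType) (g : I -> V) : (\sum_i g i).2 = \sum_i (g i).2.
      exact: (big_morph (fun z : V => z.2) (fun _ _ => erefl) erefl).
    congr pair; rewrite ?fst_sum ?snd_sum; apply/funext => i.
      rewrite fctE !fct_sumE /= [X in _ + X]big1 => [|l _]; last exact: scaler0.
      rewrite addr0 (bigD1 i)//= eqxx big1 ?addr0// => k ki.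
      by rewrite eq_sym (negPf ki).
    rewrite fctE !fct_sumE /= [X in X + _]big1 => [|l _]; last by [].
    rewrite add0r (bigD1 i)//= big1 ?addr0 => [|l li].
      by rewrite fctE /= eqxx [RHS]mulr1.
    by rewrite fctE /= eq_sym (negPf li) [LHS]mulr0.
  pose lamL := HB.pack_for {linear V -> R^o} lam
    (GRing.isLinear.Build R V R^o *:%R lam llam).
  rewrite lamD; congr (_ + _); first exact: (linear_sum lamL).
  have -> : lam (\sum_l v l *: u l) = \sum_l lam (v l *: u l).
    exact: (linear_sum lamL).
  by apply: eq_bigr => l _; exact: lamZ.
(* Since [lam] vanishes on the range of [D], it can be tested on families supported at the single
   index [t]. *)
have fG t : \sum_k c k t *: f k + \sum_l lam (u l) *: G l t = 0.
  apply/val_inj/funext => z.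
  have := lamD0 (fun t' => if t' == t then z else 0).
  have inner (W : lmodType R) (h : T -> X -> W) : (forall t', h t' 0 = 0) ->
      \sum_t' h t' (if t' == t then z else 0) = h t z.
    move=> h0; rewrite (bigD1 t)//= eqxx big1 ?addr0// => t' /negPf ->.
    exact: h0.
  rewrite lamE => h; apply: (eq_trans _ h).
  rewrite -[LHS]/((\sum_k c k t *: f k) z +
    (\sum_l lam (u l) *: G l t) z) !blin_combE; congr (_ + _).
    apply: eq_bigr => k _; rewrite (inner X (fun t' y => c k t' *: y)) => [|t'];
      last exact: scaler0.
    by rewrite linearZ.
  apply: eq_bigr => l _; rewrite (inner R^o (fun t' y => G l t' y)) => [|t'].
    by rewrite mulrC.
  exact: linear0.
(* On [X^K] the functional [lam] is dominated by the maximum norm, whose dual norm is the sum of the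
   norms. *)
have fle : \sum_k `|f k| <= 1.
  apply/ler_addgt0Pr => r r0.
  pose r' := r / (#|K|.+1)%:R.
  have r'0 : 0 < r' by rewrite divr_gt0.
  pose w k := projT1 (cid2 (dual_almost_norming (f k) r'0)).
  have wP k : `|w k| <= 1 /\ `|f k| - r' < f k (w k).
    by rewrite /w; case: cid2.
  have : \sum_k (`|f k| - r') <= 1.
    apply: (@le_trans _ _ (lam (w, 0))).
      rewrite lamE [X in _ <= _ + X]big1 ?addr0 => [|l _]; last exact: mul0r.
      by apply: ler_sum => k _; apply: ltW; have [] := wP k.
    apply: le_trans (lamN' _) _; rewrite /N /= big1 => [|l _]; last exact: normr0.
    by rewrite mulr0 addr0; apply: bigmax_le => // k _; have [] := wP k.
  rewrite sumrB sumr_const lerBlDr => /le_trans; apply; rewrite lerD2l.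
  rewrite -mulr_natr /r' -mulrA; apply: ler_piMr; first exact: ltW.
  by rewrite mulrC ler_pdivrMr// mul1r ler_nat.
(* Applying [F t] to the relation [fG t] and summing over [t] trades the values on [G] for the
   combinations of [F] that have norm at most 1. *)
have m00 : lam (0, b) = - \sum_k (\sum_t c k t *: F t) (f k).
  have : \sum_t (F t (\sum_k c k t *: f k + \sum_l lam (u l) *: G l t) : R) = 0.
    by rewrite big1 // => t _; rewrite fG linear0.
  under eq_bigr => t _.
    rewrite linearD !linear_sum.
    under eq_bigr => k _ do rewrite linearZ /=.
    under [X in _ + X]eq_bigr => l _ do rewrite linearZ /=.
    over.
  rewrite big_split/= exchange_big/= [X in _ + X]exchange_big/= addrC.
  move/eqP; rewrite addr_eq0 => /eqP h.
  rewrite lamE [X in X + _]big1 ?add0r => [|k _]; last exact: linear0.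
  transitivity (\sum_l \sum_t lam (u l) *: F t (G l t)).
    by apply: eq_bigr => l _; rewrite /b mulr_suml; apply: eq_bigr => t _; rewrite mulrC.
  by rewrite h; congr (- _); apply: eq_bigr => k _; rewrite blin_combE.
rewrite -lamb m00 -sumrN; apply: le_trans fle; apply: ler_sum => k _.
apply: le_trans (ler_norm _) _; rewrite normrN.
by apply: le_trans (blin_norm_le _ _) _; rewrite ler_piMl.
Qed.

Lemma sum_single (R : realType) (V : lmodType R) (T : finType) (t : T) (a : R)
    (F : T -> V) : \sum_t' (a *+ (t' == t)) *: F t' = a *: F t.
Proof.
rewrite (bigD1 t)//= eqxx big1 ?addr0 => [|t' /negPf ->]; last exact: scale0r.
by rewrite mulr1n.
Qed.

(** A finite net replaces the possibly infinite set [A] in [goldstine_system]. One extra row per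
    coordinate bounds the [x t], which controls the error of the net. *)
Lemma local_approximation (R : realType) (X : normedModType R) (T L : finType)
    (A : set (T -> R)) (B : R) (G : L -> T -> dual X)
    (F : T -> dual (dual X)) (eta : R) :
  (forall a t, A a -> `|a t| <= B) ->
  (forall a, A a -> `|\sum_t a t *: F t| <= 1) -> 0 < eta ->
  exists x : T -> X, (forall a, A a -> `|\sum_t a t *: x t| <= 1 + eta) /\
    forall l, `|\sum_t (G l t (x t) : R) - \sum_t (F t (G l t) : R)| <= eta.
Proof.
move=> AB F1 eta0.
pose r := 1 + \sum_t `|F t|.
have r0 : 0 < r by rewrite ltr_pwDl// sumr_ge0.
have Fr t : `|F t| <= r.
  by rewrite /r (bigD1 t)//= addrCA lerDl addr_ge0// sumr_ge0.
pose eta' := Num.min (eta / 2) 1.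
have eta'0 : 0 < eta' by rewrite lt_min ltr01 andbT divr_gt0.
have [eta'1 eta'2] : eta' <= 1 /\ eta' <= eta / 2 by rewrite !ge_min !lexx orbT.
(* The extra rows will give norms at most [2 * r], so the net costs at most
   [#|T| * d * (2 * r) <= eta / 2]. *)
pose d := eta / 2 / (2 * r * #|T|.+1%:R).
have d0 : 0 < d by rewrite !divr_gt0// !mulr_gt0.
have [K [c [cA netA]]] := bounded_net AB d0.
pose c' (k : K + T) t := match k with
  | inl k => c k t | inr t' => r^-1 *+ (t == t') end.
have [|x [xc xG]] := @goldstine_system R X _ T L c' G F eta' _ eta'0.
  move=> [k|t]/=.
    have [->|] := cA k; last exact: F1.
    by rewrite big1 ?normr0// => t _; exact: scale0r.
  rewrite sum_single normrZ gtr0_norm ?invr_gt0//.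
  by rewrite mulrC ler_pdivrMr// mul1r.
exists x; split=> [a Aa|l]; last by apply: le_trans (xG l) _; lra.
have xr t : `|x t| <= 2 * r.
  have /= := xc (inr t); rewrite sum_single normrZ gtr0_norm ?invr_gt0//.
  rewrite mulrC ler_pdivrMr// => /le_trans; apply.
  by rewrite ler_pM2r//; lra.
have [k ak] := netA _ Aa.
have -> : \sum_t a t *: x t =
    \sum_t c k t *: x t + \sum_t (a t - c k t) *: x t.
  by rewrite -big_split/=; apply: eq_bigr => t _; rewrite -scalerDl addrC subrK.
apply: le_trans (ler_normD _ _) _.
have : `|\sum_t (a t - c k t) *: x t| <= eta / 2.
  apply: le_trans (ler_norm_sum _ _ _) _.
  apply: (@le_trans _ _ (\sum_(t : T) d * (2 * r))).
    by apply: ler_sum => t _; rewrite normrZ ler_pM.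
  rewrite sumr_const -[_ *+ #|_|]mulr_natr.
  have -> : d * (2 * r) * #|T|%:R = eta / 2 * (#|T|%:R / #|T|.+1%:R).
    by rewrite /d; field; rewrite (gt_eqF r0) andbT addrC natr1 pnatr_eq0.
  apply: ler_piMr; first lra.
  by rewrite ler_pdivrMr// mul1r ler_nat.
have /= := xc (inl k); lra.
Qed.

(** * Multipliers *)

Section Multipliers.
Context {R : realType} {X : normedModType R}.
Implicit Types (f g : X -> X) (b : dual X -> R) (p : dual X).

Local Notation extreme := (extreme_point (unit_ball (dual X))).

(** The eigenvalue function is kept explicit, so that composing and combining operators becomes
    pointwise algebra on [b]; only its values at extreme points matter. *)
Definition diagonal f b :=
  linear f /\ forall p, extreme p -> forall x, p (f x) = b p * p x :> R.

Lemma norm_le_extreme (x : X) c :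
  (forall p, extreme p -> p x <= c) -> `|x| <= c.
Proof. by have [p [ep <-]] := extreme_norming x; apply. Qed.

Lemma extreme_le p x : extreme p -> p x <= `|x|.
Proof. by move=> [/unit_ball_dualP]. Qed.

Lemma diagonal_id : diagonal id (fun=> 1).
Proof. by split=> // p _ x; rewrite mul1r. Qed.

Lemma diagonal0 : diagonal (fun=> 0) (fun=> 0).
Proof.
split=> [a x y|p _ x]; first by rewrite scaler0 addr0.
by rewrite linear0 mul0r.
Qed.

Lemma diagonal_comp f g b b' : diagonal f b -> diagonal g b' ->
  diagonal (f \o g) (fun p => b p * b' p).
Proof.
move=> [lf fb] [lg gb']; split=> [a x y|p ep x]; first by rewrite /= lg lf.
by rewrite /= fb// gb'// mulrA.
Qed.

Lemma diagonal_comb c f g b b' : diagonal f b -> diagonal g b' ->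
  diagonal (fun x => c *: f x + g x) (fun p => c * b p + b' p).
Proof.
move=> [lf fb] [lg gb']; split=> [a x y|p ep x].
  by rewrite lf lg !scalerDr !scalerA addrACA (mulrC a).
rewrite linearP.
by rewrite -[LHS]/(c * (p (f x) : R) + (p (g x) : R)) fb// gb'// mulrDl mulrA.
Qed.

Lemma diagonal_sum (I : finType) (f : I -> X -> X) (b : I -> dual X -> R) :
  (forall i, diagonal (f i) (b i)) ->
  diagonal (fun x => \sum_i f i x) (fun p => \sum_i b i p).
Proof.
move=> fb; rewrite /index_enum; elim: (Finite.enum _) => [|i s IH].
  have := diagonal0; congr diagonal; apply/funext => ?; by rewrite big_nil.
have := diagonal_comb 1 (fb i) IH; congr diagonal; apply/funext => ?.
  by rewrite big_cons scale1r.
by rewrite big_cons mul1r.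
Qed.

Lemma diagonal_iter f b m : diagonal f b ->
  diagonal (iter m f) (fun p => b p ^+ m).
Proof.
move=> fb; elim: m => [|m IH]; first exact: diagonal_id.
by have := diagonal_comp fb IH; congr diagonal; apply/funext => p; rewrite exprS.
Qed.

Lemma multiplier_diagonal (T : blin X X) : multiplier T ->
  exists2 b, diagonal T b & forall p, extreme p -> `|b p| <= `|T|.
Proof.
move=> mT.
have [b bP] : {b : dual X -> R & forall p, extreme p -> adjoint T p = b p *: p}.
  apply: (@choice _ _ (fun p a => extreme p -> adjoint T p = a *: p)) => p.
  have [ep|nep] := pselect (extreme p); last by exists 0.
  by have [_ [a pa]] := mT p ep; exists a.
have bE p x : extreme p -> p (T x) = b p * p x :> R.
  by move=> ep; have /(congr1 (fun h : dual X => h x : R)) := bP p ep.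
exists b; first by split; [exact: blin_linear|move=> p ep x; exact: bE].
move=> p ep; have [p0 _] := mT p ep.
have np0 : 0 < `|p| by rewrite normr_gt0.
rewrite -(ler_pM2r np0) -normrZ -bP//.
apply: opnorm_le => [|x]; first by rewrite mulr_ge0.
apply: le_trans (blin_norm_le p (T x)) _.
by rewrite mulrAC mulrC ler_wpM2r// blin_norm_le.
Qed.

(** With [m < n] points chosen, some nonzero combination of the [T i] has eigenvalue 0 at all of
    them. It is a nonzero operator by independence, so an extreme point norming one of its nonzero
    values has nonzero eigenvalue and is separated from the earlier points. *)
Lemma separated_extreme_points n (T : 'I_n -> blin X X)
    (b : 'I_n -> dual X -> R) :
  (forall i, diagonal (T i) (b i)) -> lin_indep T ->
  forall m, (m <= n)%N -> exists (p : nat -> dual X) (z : nat -> X),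
    (forall k, (k < m)%N -> [/\ extreme (p k), `|z k| <= 1 & p k (z k) = 1]) /\
    forall k l, (k < l < m)%N -> exists i, b i (p k) != b i (p l).
Proof.
move=> Tb liT; elim=> [|m IH] mn.
  by exists (fun=> 0), (fun=> 0); split=> // k l; rewrite ltn0 andbF.
have [p [z [pz psep]]] := IH (ltnW mn).
pose M : 'M[R]_(n, m) := \matrix_(i, j) b i (p j).
have : kermx M != 0.
  rewrite -mxrank_eq0 mxrank_ker subn_eq0 -ltnNge.
  by rewrite (leq_ltn_trans (rank_leq_col M)).
rewrite -nz_row_eq0; set c := nz_row _ => c0.
have cM : c *m M = 0 by apply/sub_kermxP; exact: nz_row_sub.
pose S := \sum_i c 0 i *: T i.
have [x Sx0] : exists x, S x != 0.
  apply: contrapT => h; case/eqP: c0; apply/rowP => i; rewrite mxE.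
  apply: (liT (fun i => c 0 i)); apply/val_inj/funext => x.
  by apply/eqP; apply: contrapT => /negP ?; apply: h; exists x.
have [q [qex qS]] := extreme_norming (S x).
have qSE : q (S x) = (\sum_i c 0 i * b i q) * q x :> R.
  rewrite blin_combE linear_sum mulr_suml; apply: eq_bigr => i _.
  by rewrite linearZ -mulrA -(proj2 (Tb i)).
have cq : \sum_i c 0 i * b i q != 0.
  apply/eqP => h; move: qSE; rewrite h mul0r qS => /eqP.
  by rewrite normr_eq0 (negPf Sx0).
exists (fun k => if k == m then q else p k).
exists (fun k => if k == m then `|S x|^-1 *: S x else z k); split=> [k|k l].
  rewrite ltnS leq_eqVlt; case: eqP => [_ _|_ /=]; last exact: pz.
  split=> //; first by rewrite normrZ normfV normr_id mulVf// normr_eq0.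
  by rewrite linearZ/= qS; apply: mulVf; rewrite normr_eq0.
rewrite ltnS => /andP[kl lm]; have km := leq_trans kl lm.
rewrite (ltn_eqF km); have [_|lm'] := eqVneq l m; last first.
  by apply: psep; rewrite kl ltn_neqAle lm'.
apply: contrapT => h; case/eqP: cq.
have := congr1 (fun A : 'rV_m => A 0 (Ordinal km)) cM; rewrite !mxE.
apply: etrans; apply: eq_bigr => i _; rewrite mxE; congr (_ * _); apply/eqP.
by apply: contrapT => /negP bi; apply: h; exists i; rewrite eq_sym.
Qed.

Lemma expr_small (c e : R) : 0 <= c < 1 -> 0 < e -> exists m, c ^+ m <= e.
Proof.
move=> /andP[c0 c1] e0.
have /cvgrPdist_lt/(_ e e0) : (fun m => c ^+ m) @ \oo --> 0.
  by apply: cvg_expr; rewrite ger0_norm.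
move=> [m _ /(_ m (leqnn m))] /=; rewrite sub0r normrN ger0_norm ?exprn_ge0//.
by move/ltW; exists m.
Qed.

(* The operators are [(1 - C^-1 sum_i (T_i - b_i(p_k))^2)^m] for extreme points
   [p_k] separated by the eigenvalue functions [b_i] and [m] large: their
   eigenvalue functions peak at the [p_k] and are nearly disjoint. *)
Lemma peak_operators n (T : 'I_n -> blin X X) :
  (forall i, multiplier (T i)) -> lin_indep T ->
  exists (f : 'I_n -> X -> X) (z : 'I_n -> X),
  [/\ forall k, linear (f k),
      forall k x y, `|x| <= 1 -> `|y| <= 1 -> `|x - f k x + f k y| <= 1,
      forall y : 'I_n -> X, (forall k, `|y k| <= 1) ->
        `|\sum_k f k (y k)| <= 2,
      forall k, `|z k| <= 1 &
      forall k, 1 <= `|f k (z k)|].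
Proof.
move=> mT liT.
have [b bP] : {b : 'I_n -> dual X -> R & forall i,
    diagonal (T i) (b i) /\ forall p, extreme p -> `|b i p| <= `|T i|}.
  apply: (@choice _ _ (fun i b =>
    diagonal (T i) b /\ forall p, extreme p -> `|b p| <= `|T i|)) => i.
  by have [b ? ?] := multiplier_diagonal (mT i); exists b.
have [p [z [pz psep]]] :=
  separated_extreme_points (fun i => proj1 (bP i)) liT (leqnn n).
pose del (k : nat) q := \sum_i (b i q - b i (p k)) ^+ 2.
have del0 k q : 0 <= del k q by apply: sumr_ge0 => i _; exact: sqr_ge0.
(* Eigenvalues of [T i] are at most its norm in absolute value, so [C] bounds every [del k q]; the
   summand 1 keeps it positive. *)
pose C := 1 + \sum_i 4 * `|T i| ^+ 2.
have C0 : 0 < C.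
  by rewrite ltr_pwDl// sumr_ge0// => i _; rewrite mulr_ge0// exprn_ge0.
have delC (k : 'I_n) q : extreme q -> del k q <= C.
  move=> qex; apply: (@le_trans _ _ (\sum_i 4 * `|T i| ^+ 2)); last by rewrite lerDr.
  apply: ler_sum => i _; have [epk _ _] := pz k (ltn_ord k).
  have := (bP i).2 _ qex; have := (bP i).2 _ epk; rewrite !ler_norml.
  have : 0 <= `|T i| by [].
  set t := `|T i|; set u := b i q; set v := b i (p k) => t0 /andP[? ?] /andP[? ?].
  nra.
have [s s0 sP] : exists2 s, 0 < s &
    forall k l : 'I_n, k != l -> s <= del k (p l).
  exists (\big[Num.min/1]_(kl : 'I_n * 'I_n | kl.1 != kl.2) del kl.1 (p kl.2)).
    apply: lt_bigmin => // -[k l] /= kl.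
    have [i bi] : exists i, b i (p l) != b i (p k).
      have [kl'|lk'|/val_inj kl'] := ltngtP k l.
      - have [|i bi] := psep k l; first by rewrite kl' /=.
        by exists i; rewrite eq_sym.
      - by have [|i bi] := psep l k; [rewrite lk' /=|exists i].
      - by rewrite kl' eqxx in kl.
    rewrite /del (bigD1 i)//= ltr_pwDl// ?exprn_even_gt0//= ?subr_eq0//.
    by apply: sumr_ge0 => j _; exact: sqr_ge0.
  by move=> k l kl; exact: (@bigmin_le_cond _ _ _ _ (k, l)).
(* Where [del k q >= s / 4], the base [1 - C^-1 * del k q] is at most [th], and its [m]-th power at
   most [1 / (n + 1)]. The maximum with 0 supplies the nonnegativity asked by [expr_small]. *)
pose th := 1 - s / (4 * C).
have th1 : 0 <= Num.max 0 th < 1.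
  by rewrite le_max lexx gt_max ltr01/= ltrBlDr ltrDl divr_gt0// mulr_gt0.
have [m mP] := expr_small th1 (e := n.+1%:R^-1) ltac:(by rewrite invr_gt0).
pose bet (k : 'I_n) q := (1 - C^-1 * del k q) ^+ m.
have /choice[f fP] : forall k : 'I_n, exists f, diagonal f (bet k).
  move=> k; pose g i x := - b i (p k) *: x + T i x.
  have gP i : diagonal (g i) _ :=
    diagonal_comb (- b i (p k)) diagonal_id (proj1 (bP i)).
  have := diagonal_iter m (diagonal_comb (- C^-1)
    (diagonal_sum (fun i => diagonal_comp (gP i) (gP i))) diagonal_id).
  set h := iter _ _ => hP; exists h; move: hP; congr diagonal.
  apply/funext => q; rewrite /bet mulNr addrC; congr ((1 - _ * _) ^+ _).
  by apply: eq_bigr => i _; ring.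
exists f, (fun k => z k).
have bet01 k q : extreme q -> 0 <= bet k q <= 1.
  move=> qex; have : 0 <= 1 - C^-1 * del k q <= 1.
    rewrite lerBlDr lerDl subr_ge0 ler_pdivrMl// mulr1 delC//=.
    by rewrite mulr_ge0// invr_ge0 ltW.
  by move=> /andP[h0 h1]; rewrite exprn_ge0//= exprn_ile1.
split=> [k|k x y x1 y1|y y1|k|k].
- by have [] := fP k.
(* At an extreme point the value is a convex combination of [q x] and [q y] with weight
   [bet k q]. *)
- apply: norm_le_extreme => q qex; have [_ fq] := fP k.
  rewrite linearD linearB -[leLHS]/(q x - q (f k x) + q (f k y) : R).
  rewrite !(fq _ qex).
  have := le_trans (extreme_le x qex) x1; have := le_trans (extreme_le y qex) y1.
  by have /andP[? ?] := bet01 k q qex => qy qx; nra.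
- apply: norm_le_extreme => q qex; rewrite linear_sum.
  have smallP (k : 'I_n) : s / 4 <= del k q -> bet k q <= n.+1%:R^-1.
    move=> sk; apply: le_trans mP; rewrite lerXn2r ?nnegrE//.
    + rewrite subr_ge0 ler_pdivrMl// mulr1; exact: delC.
    + by case/andP: th1.
    + rewrite le_max; apply/orP; right; rewrite lerB// ler_pdivlMl//.
      suff -> : C * (s / (4 * C)) = s / 4 by [].
      by field; rewrite gt_eqF.
  (* Eigenvalue vectors of distinct points are at squared distance at least [s], so at most one
     index [k] has [del k q < s / 4]. Its term is at most 1 and the remaining small ones add up to
     at most 1. *)
  have uniqP (k l : 'I_n) : k != l -> del k q < s / 4 -> s / 4 <= del l q.
    move=> kl sk; have : s <= 2 * del k q + 2 * del l q.
      apply: le_trans (sP _ _ kl) _; rewrite /del !mulr_sumr -big_split/=.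
      apply: ler_sum => i _; rewrite -subr_ge0.
      set u := b i q; set v := b i _; set w := b i _.
      have -> : 2 * (u - v) ^+ 2 + 2 * (u - w) ^+ 2 - (w - v) ^+ 2 =
        (2 * u - v - w) ^+ 2 by ring.
      exact: sqr_ge0.
    by lra.
  have sumP (P : pred 'I_n) : (forall k, P k -> s / 4 <= del k q) ->
      \sum_(k | P k) bet k q <= 1.
    move=> sk; apply: (@le_trans _ _ (\sum_(k | P k) n.+1%:R^-1)).
      by apply: ler_sum => k /sk; exact: smallP.
    rewrite sumr_const -[_ *+ #|_|]mulr_natl ler_pdivrMr// mul1r ler_nat.
    by apply: leq_trans (max_card _) _; rewrite card_ord.
  apply: (@le_trans _ _ (\sum_k bet k q)).
    apply: ler_sum => k _; have [_ fq] := fP k.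
    rewrite -[leLHS]/(q (f k (y k)) : R) fq//.
    have /andP[h0 h1] := bet01 k q qex.
    by rewrite ler_piMr// (le_trans (extreme_le _ qex)).
  have [[k sk]|nsk] := pselect (exists k : 'I_n, del k q < s / 4).
    rewrite (bigD1 k)//= -[leRHS]/(1 + 1) lerD//.
      by have /andP[] := bet01 k q qex.
    by apply: sumP => l lk; apply: uniqP sk; rewrite eq_sym.
  apply: le_trans (sumP predT _) _; last by rewrite ler1n.
  by move=> k _; rewrite leNgt; apply/negP => sk; apply: nsk; exists k.
- by have [] := pz k (ltn_ord k).
have [ep zk pzk] := pz k (ltn_ord k).
apply: le_trans (extreme_le (f k (z k)) ep).
rewrite (proj2 (fP k))// pzk mulr1 /bet /del big1 ?mulr0 ?subr0 ?expr1n//.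
by move=> i _; rewrite subrr expr0n.
Qed.

End Multipliers.

(** * Perturbations with an elementary tensor *)

Lemma big_option (V : nmodType) (J : finType) (F : option J -> V) :
  \sum_t F t = F None + \sum_j F (Some j).
Proof.
rewrite (bigD1 None)//=; congr (_ + _).
rewrite (reindex_omap Some id) => [|[j|]//].
by apply: eq_bigl => j; rewrite eqxx.
Qed.

Section Perturbation.
Context {R : realType}.
Implicit Type X : normedModType R.

(* [A] plays the role of the set of vectors [(q (y t))_t], with [q] in the unit
   ball of [Y^*], for a family [y] in [Y]; then [tensor_ball A] consists of the
   [x] such that the tensor [sum_t x t (x) y t] has injective norm at most 1. *)
Definition tensor_ball X (T : finType) (A : set (T -> R)) : set (T -> X) :=
  [set x | forall a, A a -> `|\sum_t a t *: x t| <= 1].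

(** Continuing the analogy, these are the families [g] for which [sum_t x t (x) y t] is sent to
    [sum_t g t (x t)] with norm at most 1. *)
Definition tensor_polar X (T : finType) (A : set (T -> R)) :
    set (T -> dual X) :=
  [set g | forall x, tensor_ball A x -> \sum_t (g t (x t) : R) <= 1].

Lemma tensor_polar_le X (T : finType) (A : set (T -> R)) (g : T -> dual X)
    (x : T -> X) (c : R) : tensor_polar A g -> 0 < c ->
  (forall a, A a -> `|\sum_t a t *: x t| <= c) ->
  \sum_t (g t (x t) : R) <= c.
Proof.
move=> gA c0 xc.
have := gA (fun t => c^-1 *: x t); rewrite -(ler_pM2l c0) mulr1.
have -> : c * \sum_t (g t (c^-1 *: x t) : R) = \sum_t (g t (x t) : R).
  rewrite mulr_sumr; apply: eq_bigr => t _.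
  by rewrite linearZ; apply: mulVKf; rewrite gt_eqF.
apply => a Aa; have := xc a Aa.
have -> : \sum_t a t *: (c^-1 *: x t) = c^-1 *: \sum_t a t *: x t.
  by rewrite scaler_sumr; apply: eq_bigr => t _; rewrite !scalerA mulrC.
by rewrite normrZ gtr0_norm ?invr_gt0// ler_pdivrMl// mulr1.
Qed.

(* The SSD2P of [X (x) Y] for slices at tensors [sum_j x i j (x) y i j], with
   the perturbation required to be elementary, of the form [z (x) y0]. *)
Definition perturbable X (I J : finType) (A : I -> set (option J -> R)) (e : R) :=
  forall (g : I -> option J -> dual X) (x : I -> J -> X),
  (forall i, tensor_polar (A i) (g i)) ->
  (forall i a, A i a -> `|\sum_j a (Some j) *: x i j| <= 1) ->
  forall e', e < e' -> exists (x' : I -> J -> X) (z : X),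
  [/\ forall i a (s : bool), A i a ->
        `|\sum_j a (Some j) *: x' i j + (-1) ^+ s *: (a None *: z)| <= 1 + e',
      forall i, \sum_j (g i (Some j) (x i j) : R) - e' <=
                \sum_j (g i (Some j) (x' i j) : R),
      forall i, `|g i None z| <= e' &
      1 - e' <= `|z|].

(** Averaging: if each [k] had some [i] with a term above [e], the double sum would exceed
    [e * n]. *)
Lemma exists_small_term (n : nat) (I : finType) (r : I -> 'I_n -> R) (c e : R) :
  (0 < n)%N -> (forall i k, 0 <= r i k) -> (forall i, \sum_k r i k <= c) ->
  c * #|I|%:R <= e * n%:R -> exists k, forall i, r i k <= e.
Proof.
move=> n0 r0 rc ce; apply: contrapT => h.
have : e * n%:R < c * #|I|%:R.
  apply: (@lt_le_trans _ _ (\sum_k \sum_i r i k)).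
    have -> : e * n%:R = \sum_(k < n) e by rewrite sumr_const card_ord mulr_natr.
    have [m nE] : exists m, n = m.+1 by exists n.-1; rewrite prednK.
    move: r r0 rc h ce; rewrite nE => r r0 rc h ce.
    apply: ltr_sum => [|k _]; first by apply/hasP; exists ord0; rewrite ?mem_index_enum.
    rewrite ltNge; apply/negP => he; apply: h; exists k => i.
    by apply: le_trans he; rewrite (bigD1 i)//= lerDl sumr_ge0.
  rewrite exchange_big/=.
  apply: (@le_trans _ _ (\sum_(i : I) c)); first exact: ler_sum.
  by rewrite sumr_const -[_ *+ #|_|]mulr_natr.
by rewrite ltNge ce.
Qed.

Lemma sum_norm_sign (n : nat) (r : 'I_n -> R) :
  \sum_k `|r k| = \sum_k Num.sg (r k) * r k.
Proof. by apply: eq_bigr => k _; exact: normrEsg. Qed.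

(** The witnesses are [x - f_k x] and [f_k z_k]. For each [i] the errors [r1] and [r2] they cause
    have absolute sums over [k] of at most 2 each, whence the constant 4, and averaging gives a [k]
    good for all [i]. *)
Lemma perturbable_multiplier X (n : nat) (T : 'I_n -> blin X X) (I J : finType)
    (A : I -> set (option J -> R)) (e : R) :
  (forall i, multiplier (T i)) -> lin_indep T -> (0 < n)%N -> 0 <= e ->
  (forall i a, A i a -> `|a None| <= 1) ->
  4 * #|I|%:R <= e * n%:R -> perturbable X A e.
Proof.
move=> mT liT n0 e0 A1 en g x gA xA e' ee'.
have [f [z [lf f1 f2 z1 fz]]] := peak_operators mT liT.
pose fL k := HB.pack_for {linear X -> X} (f k)
  (GRing.isLinear.Build R X X *:%R (f k) (lf k)).
have fZ k a y : f k (a *: y) = a *: f k y by exact: (linearZZ (fL k)).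
have fsum k (h : J -> X) : f k (\sum_j h j) = \sum_j f k (h j).
  exact: (linear_sum (fL k)).
have sg1 (a : R) : `|Num.sg a| <= 1 by rewrite normr_sg; case: (_ == _).
have ball_sg (a : R) (y : X) : `|y| <= 1 -> `|Num.sg a *: y| <= 1.
  by move=> y1; rewrite normrZ mulr_ile1.
pose r1 i k := \sum_j (g i (Some j) (f k (x i j)) : R).
pose r2 i k := g i None (f k (z k)) : R.
(* With the signs inserted, the sum is the value of [g i] on a tensor whose norm is at most 2 by
   [f2]. *)
have r1P i : \sum_k `|r1 i k| <= 2.
  rewrite sum_norm_sign.
  pose w (t : option J) := if t is Some j then
    \sum_k f k (Num.sg (r1 i k) *: x i j) else 0.
  have := @tensor_polar_le X _ (A i) (g i) w 2 (gA i) ltac:(lra).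
  rewrite big_option linear0 add0r.
  have -> : \sum_j (g i (Some j) (w (Some j)) : R) =
            \sum_k Num.sg (r1 i k) * r1 i k.
    under [RHS]eq_bigr => k _ do rewrite {2}/r1 mulr_sumr.
    rewrite exchange_big/=; apply: eq_bigr => j _; rewrite linear_sum.
    by apply: eq_bigr => k _; rewrite fZ linearZ.
  apply => a Aa; rewrite big_option scaler0 add0r /w.
  have -> : \sum_j a (Some j) *: (\sum_k f k (Num.sg (r1 i k) *: x i j)) =
      \sum_k f k (Num.sg (r1 i k) *: \sum_j a (Some j) *: x i j).
    under eq_bigr => j _ do rewrite scaler_sumr.
    rewrite exchange_big/=; apply: eq_bigr => k _.
    rewrite scaler_sumr fsum; apply: eq_bigr => j _.
    by rewrite scalerA mulrC -scalerA fZ -fZ.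
  by apply: f2 => k; apply: ball_sg; exact: xA.
have r2P i : \sum_k `|r2 i k| <= 2.
  rewrite sum_norm_sign.
  pose w (t : option J) := if t is Some j then 0 else
    \sum_k f k (Num.sg (r2 i k) *: z k).
  have := @tensor_polar_le X _ (A i) (g i) w 2 (gA i) ltac:(lra).
  rewrite big_option [X in _ + X]big1 => [|j _]; last exact: linear0.
  rewrite addr0.
  have -> : g i None (w None) = \sum_k Num.sg (r2 i k) * r2 i k :> R.
    by rewrite linear_sum; apply: eq_bigr => k _; rewrite fZ linearZ.
  apply => a Aa; rewrite big_option [X in _ + X]big1 => [|j _]; last exact: scaler0.
  rewrite addr0 normrZ; apply: (@le_trans _ _ (1 * 2)); last by rewrite mul1r.
  by apply: ler_pM => //; [exact: A1 Aa|apply: f2 => k; exact: ball_sg].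
have [|i|k rk] := @exists_small_term n I (fun i k => `|r1 i k| + `|r2 i k|) 4 e n0 _ _ en.
- by move=> i k; exact: addr_ge0.
- by rewrite big_split/=; have := r1P i; have := r2P i; lra.
have rk1 i : `|r1 i k| <= e' by have := rk i; have : 0 <= `|r2 i k| by []; lra.
have rk2 i : `|r2 i k| <= e' by have := rk i; have : 0 <= `|r1 i k| by []; lra.
exists (fun i j => x i j - f k (x i j)), (f k (z k)); split=> [i a s Aa|i|i|].
- set u := \sum_j a (Some j) *: x i j.
  have -> : \sum_j a (Some j) *: (x i j - f k (x i j)) = u - f k u.
    rewrite fsum /u -sumrB; apply: eq_bigr => j _.
    by rewrite scalerBr fZ.
  rewrite -!fZ; apply: (@le_trans _ _ 1).
    apply: f1; first exact: xA.
    rewrite normrZ normrX normrN1 expr1n mul1r normrZ.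
    by apply: mulr_ile1 => //; exact: A1 Aa.
  by have := rk1 i; have : 0 <= `|r1 i k| by []; lra.
- have := rk1 i; rewrite ler_norml => /andP[_ h].
  rewrite [leRHS](_ : _ = \sum_j (g i (Some j) (x i j) : R) - r1 i k) ?lerD2l ?lerN2//.
  by rewrite /r1 -sumrB; apply: eq_bigr => j _; rewrite linearB.
- exact: rk2.
by apply: le_trans (fz k); lra.
Qed.

End Perturbation.

(** * Descent from the bidual *)

Lemma big_option_pair (V : nmodType) (I J : finType) (F : option (I * J) -> V) :
  \sum_t F t = F None + \sum_i \sum_j F (Some (i, j)).
Proof.
by rewrite big_option pair_bigA; congr (_ + _); apply: eq_bigr => -[].
Qed.

Lemma eval_comb (R : realType) (X : normedModType R) (J : finType) (a : J -> R)
    (x : J -> X) : \sum_j a j *: Defs.eval (x j) = Defs.eval (\sum_j a j *: x j).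
Proof.
apply/val_inj/funext => p.
transitivity ((\sum_j a j *: Defs.eval (x j)) p : R) => //.
rewrite blin_combE -[RHS]/(p (\sum_j a j *: x j) : R) linear_sum.
by apply: eq_bigr => j _; rewrite linearZ.
Qed.

(** A family in the bidual is approximated by one in [X] with nearly the same tensor bound and
    nearly the same value of [g]. *)
Lemma tensor_polar_eval (R : realType) (X : normedModType R) (T : finType)
    (A : set (T -> R)) (B : R) (g : T -> dual X) :
  (forall a t, A a -> `|a t| <= B) -> tensor_polar A g ->
  tensor_polar (X := dual (dual X)) A (fun t => Defs.eval (g t)).
Proof.
move=> AB gA F FA; apply/ler_addgt0Pr => e e0.
have e20 : 0 < e / 2 by rewrite divr_gt0.
have [x [xA /(_ tt)]] := @local_approximation R X T unit A B (fun=> g) F _ AB FA e20.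
rewrite ler_distl => /andP[h _].
have := tensor_polar_le gA (ltr_pwDl ltr01 (ltW e20)) xA.
suff -> : \sum_t (Defs.eval (g t) (F t) : R) = \sum_t (F t (g t) : R) by lra.
by [].
Qed.

(** All requirements on a solution in the bidual are norm bounds or values of finitely many
    functionals, so [local_approximation] transfers them together. The lower bound on [Z] becomes
    such a value through an almost norming [p]. *)
Lemma perturbable_bidual (R : realType) (X : normedModType R) (I J : finType)
    (A : I -> set (option J -> R)) (B e : R) : 0 <= e ->
  (forall i a t, A i a -> `|a t| <= B) ->
  perturbable (dual (dual X)) A e -> perturbable X A e.
Proof.
move=> e0 AB pX g x gA xA e' ee'.
(* The bidual is used with tolerance [e + d]; the other half of the gap absorbs the
   approximation. *)
pose d := (e' - e) / 2; have d0 : 0 < d by rewrite /d; lra.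
have [|||F [Z [FZ1 Fg Zg Z1]]] := pX (fun i t => Defs.eval (g i t))
    (fun i j => Defs.eval (x i j)) _ _ (e + d).
- by move=> i; exact: tensor_polar_eval (AB i) (gA i).
- move=> i a Aa; rewrite eval_comb; apply: le_trans (eval_norm_le _) _.
  exact: xA.
- by rewrite ltrDl.
set e'' := e + d in FZ1 Fg Zg Z1.
have dE : d = (e' - e) / 2 by [].
have e''E : e'' = e + d by [].
have e''0 : 0 < 1 + e'' by lra.
have d20 : 0 < d / 2 by rewrite divr_gt0.
have [p p1 Zp] := dual_almost_norming Z d20.
pose eta := Num.min (d / 2) (d / (1 + e'')).
have eta0 : 0 < eta by rewrite lt_min d20 divr_gt0.
have [eta1 eta2] : eta <= d / 2 /\ eta <= d / (1 + e'').
  by rewrite !ge_min !lexx orbT.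
pose T := option (I * J)%type.
pose FT (t : T) := if t is Some ij then F ij.1 ij.2 else Z.
(* One index type [T] carries the unknowns of all [i] and the common [z]; the factor normalises the
   bound [FZ1] to 1. *)
pose row i (s : bool) (a : option J -> R) (t : T) : R := (1 + e'')^-1 *
  match t with
  | Some (i', j) => a (Some j) *+ (i' == i)
  | None => (-1) ^+ s * a None
  end.
pose AT : set (T -> R) := [set b | exists i s a, A i a /\ b = row i s a].
have rowE (W : lmodType R) i s a (h : T -> W) : \sum_t row i s a t *: h t =
    (1 + e'')^-1 *: (\sum_j a (Some j) *: h (Some (i, j)) +
      (-1) ^+ s *: (a None *: h None)).
  rewrite big_option_pair addrC scalerDr /row !scalerA; congr (_ + _);
    last by rewrite mulrA.
  rewrite (bigD1 i)//= [X in _ + X]big1 => [|i' ii'].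
    rewrite addr0 scaler_sumr; apply: eq_bigr => j _.
    by rewrite eqxx scalerA.
  by apply: big1 => j _; rewrite (negPf ii') mulr0 scale0r.
(* For each [i], [true] tests the new tensor and [false] tests [z]; [None] tests the norm of [z]. *)
pose GT (l : option (I * bool)) (t : T) : dual X := match l, t with
  | Some (i, true), Some (i', j) => g i (Some j) *+ (i' == i)
  | Some (i, false), None => g i None
  | None, None => p
  | _, _ => 0
  end.
have GT1 i (k : dual X -> T -> R) : (forall t, k 0 t = 0) ->
    \sum_t k (GT (Some (i, true)) t) t = \sum_j k (g i (Some j)) (Some (i, j)).
  move=> k0; rewrite big_option_pair k0 add0r (bigD1 i)//=.
  rewrite [X in _ + X]big1 => [|i' ii'].
    by rewrite addr0; apply: eq_bigr => j _; rewrite eqxx.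
  by apply: big1 => j _; rewrite (negPf ii') k0.
have GT2 i (k : dual X -> T -> R) : (forall t, k 0 t = 0) ->
    \sum_t k (GT (Some (i, false)) t) t = k (g i None) None.
  by move=> k0; rewrite big_option big1 ?addr0// => -[].
have GT3 (k : dual X -> T -> R) : (forall t, k 0 t = 0) ->
    \sum_t k (GT None t) t = k p None.
  by move=> k0; rewrite big_option big1 ?addr0// => -[].
have [||y [yA yG]] := @local_approximation R X T _ AT ((1 + e'')^-1 * B) GT FT eta _ _ eta0.
- move=> b t [i [s [a [Aa ->]]]]; rewrite /row normrM gtr0_norm ?invr_gt0//.
  rewrite ler_pM2l ?invr_gt0//.
  have B0 : 0 <= B by exact: le_trans (normr_ge0 _) (AB i a None Aa).
  case: t => [[i' j]|]; last first.
    by rewrite normrM normrX normrN1 expr1n mul1r; exact: AB Aa.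
  by case: eqP => _; [exact: AB Aa|rewrite normr0].
- move=> b [i [s [a [Aa ->]]]]; rewrite rowE normrZ gtr0_norm ?invr_gt0//.
  by rewrite ler_pdivrMl// mulr1; exact: FZ1.
have e1 : (1 + e'') * (1 + eta) <= 1 + e'.
  have : (1 + e'') * eta <= d by rewrite mulrC -ler_pdivlMr.
  by rewrite mulrDr mulr1; lra.
exists (fun i j => y (Some (i, j))), (y None); split=> [i a s Aa|i|i|].
- have := yA (row i s a); rewrite rowE normrZ gtr0_norm ?invr_gt0//.
  rewrite ler_pdivrMl// => h; apply: le_trans (h _) e1.
  by exists i, s, a.
- have := yG (Some (i, true)).
  rewrite (GT1 i (fun q t => q (y t)))// (GT1 i (fun q t => FT t q))/=; last first.
    by move=> t; exact: linear0.
  rewrite ler_distl => /andP[h _]; have := Fg i.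
  suff -> : \sum_j (Defs.eval (g i (Some j)) (F i j) : R) =
            \sum_j (F i j (g i (Some j)) : R).
    suff -> : \sum_j (Defs.eval (g i (Some j)) (Defs.eval (x i j)) : R) =
              \sum_j (g i (Some j) (x i j) : R).
      lra.
    by [].
  by [].
- have := yG (Some (i, false)).
  rewrite (GT2 i (fun q t => q (y t)))// (GT2 i (fun q t => FT t q))/=; last first.
    by move=> t; exact: linear0.
  have := Zg i; rewrite -[Defs.eval _ Z]/(Z (g i None)).
  set u := Z _; set v := g _ _ _.
  rewrite !ler_norml => /andP[? ?] /andP[? ?]; apply/andP.
  by split; lra.
have := yG None; rewrite (GT3 (fun q t => q (y t)))// (GT3 (fun q t => FT t q))/=;
  last by move=> t; exact: linear0.
rewrite ler_distl => /andP[h _].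
have : p (y None) <= `|y None|.
  apply: le_trans (ler_norm _) _; apply: le_trans (blin_norm_le _ _) _.
  by rewrite ler_piMl.
lra.
Qed.

(** * Injective tensor products *)

Section Tensors.
Context {R : realType} {X Y : normedModType R}.

Lemma elem_tensor_inj (x : X) (y : Y) :
  elem_tensor x y \in @is_inj_tensor R X Y.
Proof.
rewrite inE; apply: subset_closure; exists [:: (x, y)].
by rewrite big_seq1.
Qed.

Definition elem (x : X) (y : Y) : inj_tensor X Y :=
  InjTensor (elem_tensor_inj x y).

Lemma elem_linear y : linear (elem^~ y).
Proof.
move=> a x x'; apply/val_inj/val_inj/funext => p; apply/val_inj/funext => q.
have px : p (a *: x + x') = a * p x + p x' :> R by exact: linearP.
suff : p (a *: x + x') * q y = a * (p x * q y) + p x' * q y :> R by [].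
by rewrite px mulrDl mulrA.
Qed.

Lemma elemZ a x y : elem (a *: x) y = a *: elem x y.
Proof.
have e0 : elem 0 y = 0.
  by have := elem_linear y (-1) 0 0; rewrite !scaleN1r oppr0 addr0 addNr.
by have := elem_linear y a x 0; rewrite e0 !addr0.
Qed.

Lemma elem0 x : elem x 0 = 0.
Proof.
apply/val_inj/val_inj/funext => p; apply/val_inj/funext => q.
suff : p x * q 0 = 0 :> R by [].
by rewrite linear0 mulr0.
Qed.

Lemma inj_tensor_sumE (I : Type) (s : seq I) (F : I -> inj_tensor X Y) :
  inj_tensor_val (\sum_(i <- s) F i) = \sum_(i <- s) inj_tensor_val (F i).
Proof. exact: (big_morph (@inj_tensor_val R X Y) (fun _ _ => erefl) erefl). Qed.

Lemma sum_elemE (T : finType) (x : T -> X) (y : T -> Y) p q :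
  inj_tensor_val (\sum_t elem (x t) (y t)) p q = p (\sum_t q (y t) *: x t).
Proof.
rewrite inj_tensor_sumE blin_sumE (@blin_sumE R (dual Y) R^o) linear_sum.
by apply: eq_bigr => t _; rewrite linearZ; exact: mulrC.
Qed.

(** Together with [sum_elem_norm_ge] this reduces the injective norm to norms in [X], by applying
    [q] to the second factors. *)
Lemma sum_elem_norm_le (T : finType) (x : T -> X) (y : T -> Y) (c : R) :
  (forall q : dual Y, `|q| <= 1 -> `|\sum_t q (y t) *: x t| <= c) ->
  `|\sum_t elem (x t) (y t)| <= c.
Proof.
move=> h.
have c0 : 0 <= c.
  by apply: le_trans (normr_ge0 _) (h 0 _); rewrite normr0.
have hq (q : dual Y) : `|\sum_t q (y t) *: x t| <= c * `|q|.
  have [->|q0] := eqVneq q 0.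
    rewrite normr0 mulr0 big1 ?normr0// => t _.
    by rewrite -[X in X *: _]/(0 : R) scale0r.
  have nq0 : 0 < `|q| by rewrite normr_gt0.
  have := h (`|q|^-1 *: q); rewrite normrZ normfV normr_id mulVf ?gt_eqF//.
  move=> /(_ (lexx _)).
  have -> : \sum_t (`|q|^-1 *: q : dual Y) (y t) *: x t =
      `|q|^-1 *: \sum_t q (y t) *: x t.
    by rewrite scaler_sumr; apply: eq_bigr => t _; rewrite scalerA.
  by rewrite normrZ normfV normr_id ler_pdivrMl// mulrC.
apply: opnorm_le => // p; apply: opnorm_le => [|q]; first exact: mulr_ge0.
rewrite sum_elemE; apply: le_trans (blin_norm_le _ _) _.
by rewrite mulrAC mulrC ler_wpM2r.
Qed.

Lemma sum_elem_norm_ge (T : finType) (x : T -> X) (y : T -> Y) (q : dual Y) :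
  `|q| <= 1 -> `|\sum_t q (y t) *: x t| <= `|\sum_t elem (x t) (y t)|.
Proof.
move=> q1; have [p p1 pE] := dual_norming (\sum_t q (y t) *: x t).
rewrite -pE -sum_elemE; apply: le_trans (ler_norm _) _.
set u := \sum_t _; rewrite -[leRHS]/(`|inj_tensor_val u|).
apply: le_trans (blin_norm_le _ _) _; apply: (@le_trans _ _ `|inj_tensor_val u p|).
  by rewrite ler_piMr.
by apply: le_trans (blin_norm_le _ _) _; rewrite ler_piMr.
Qed.

Lemma elem_norm_le x y : `|elem x y| <= `|x| * `|y|.
Proof.
have := @sum_elem_norm_le unit (fun=> x) (fun=> y) (`|x| * `|y|).
rewrite big_const card_unit /= addr0; apply=> q q1.
rewrite big_const card_unit /= addr0 normrZ mulrC ler_wpM2l//.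
by apply: le_trans (blin_norm_le q y) _; rewrite ler_piMl.
Qed.

Lemma elem_norm_ge x y : `|y| = 1 -> `|x| <= `|elem x y|.
Proof.
move=> y1; have [q q1 qy] := dual_norming y.
have := @sum_elem_norm_ge unit (fun=> x) (fun=> y) q q1.
by rewrite !big_const card_unit /= !addr0 qy y1 scale1r.
Qed.

(** Finite tensors are dense. The loss [3 * d] covers the choice of [w], its approximation and the
    rescaling into the ball. *)
Lemma slice_elem (phi : dual (inj_tensor X Y)) (d : R) : `|phi| = 1 -> 0 < d ->
  exists s : seq (X * Y), `|\sum_(z <- s) elem z.1 z.2| <= 1 /\
    1 - 3 * d <= phi (\sum_(z <- s) elem z.1 z.2).
Proof.
move=> phi1 d0; have [w w1] := dual_almost_norming phi d0.
rewrite phi1 => phiw.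
have := inj_tensorP w; rewrite inE => /(_ _ (nbhsx_ballx _ _ d0)).
move=> [_ [[s ->]]]; rewrite -ball_normE /=.
have -> : \sum_(z <- s) elem_tensor z.1 z.2 =
    inj_tensor_val (\sum_(z <- s) elem z.1 z.2) by rewrite inj_tensor_sumE.
set u := \sum_(z <- s) elem _ _; rewrite -[ltLHS]/(`|w - u|) => wu.
have d1 : 0 < 1 + d by lra.
exists [seq ((1 + d)^-1 *: z.1, z.2) | z <- s].
have -> : \sum_(z <- [seq ((1 + d)^-1 *: z.1, z.2) | z <- s]) elem z.1 z.2 =
    (1 + d)^-1 *: u.
  by rewrite big_map scaler_sumr; apply: eq_bigr => z _; rewrite elemZ.
split.
  rewrite normrZ gtr0_norm ?invr_gt0// ler_pdivrMl// mulr1.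
  have -> : u = w - (w - u) by rewrite opprB addrC subrK.
  by apply: le_trans (ler_normB _ _) _; rewrite lerD// ltW.
have -> : phi ((1 + d)^-1 *: u) = (1 + d)^-1 * phi u :> R by exact: linearZ.
rewrite ler_pdivlMl//.
have -> : phi u = phi w - phi (w - u) :> R.
  by rewrite linearB opprB addrC subrK.
have : phi (w - u) <= d.
  apply: le_trans (ler_norm _) _; apply: le_trans (blin_norm_le _ _) _.
  by rewrite phi1 mul1r ltW.
have : 0 <= d * d by rewrite mulr_ge0 // ltW.
by move=> ? ?; rewrite mulrBr mulr1 mulrDl mul1r; nra.
Qed.

End Tensors.

(** * Even duals and the reduction of the SSD2P to perturbations *)

Lemma even_dual_multipliers (R : realType) (X : completeNormedModType R) :
  ereal_sup [set dimension (centralizer (even_dual X n)) | n in [set: nat]]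
    = +oo%E ->
  forall N, exists n m (T : 'I_m -> blin (even_dual X n) (even_dual X n)),
    [/\ (N <= m)%N, forall i, multiplier (T i) & lin_indep T].
Proof.
move=> supZ N.
have : (N%:R%:E < ereal_sup
    [set dimension (centralizer (even_dual X n)) | n in [set: nat]])%E.
  by rewrite supZ ltry.
move=> /ereal_sup_gt[_ [n _ <-]] /ereal_sup_gt[_ [m [T [mT liT]] <-]].
rewrite lte_fin ltr_nat => Nm.
by exists n, m, T; split=> //; exact: ltnW.
Qed.

Lemma perturbable_even_dual (R : realType) (X : completeNormedModType R)
    (I J : finType) (A : I -> set (option J -> R)) (B e : R) (n : nat) : 0 <= e ->
  (forall i a t, A i a -> `|a t| <= B) ->
  perturbable (even_dual X n) A e -> perturbable X A e.
Proof.
move=> e0 AB; elim: n => [//|n IH] /= p; apply: IH.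
exact: perturbable_bidual AB p.
Qed.

(** Padding lets the tensors of different slices share one index set. *)
Lemma big_nth_pad (V : nmodType) (T : Type) (x0 : T) (s : seq T) (m : nat)
    (F : T -> V) : F x0 = 0 -> (size s <= m)%N ->
  \sum_(z <- s) F z = \sum_(j < m) F (nth x0 s j).
Proof.
move=> F0 sm; rewrite (big_nth x0) big_mkord (big_ord_widen m (fun j => F (nth x0 s j)))//.
rewrite [RHS](bigID (fun j : 'I_m => (j < size s)%N))/= [X in _ + X]big1 ?addr0//.
by move=> j; rewrite -leqNgt => /(nth_default x0) ->.
Qed.

Lemma slice_average (R : realType) (V : normedModType R) (S : set V) (x y : V) :
  is_slice S -> S (x + y) -> S (x - y) -> S x.
Proof.
move=> [p [a [_ _ ->]]] [b1 p1] [b2 p2].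
have xE : x = 2^-1 *: ((x + y) + (x - y)).
  by rewrite addrACA subrr addr0 -mulr2n -[x *+ 2]scaler_nat scalerA mulVf// scale1r.
split.
  rewrite /unit_ball/= in b1 b2 *; rewrite xE normrZ gtr0_norm ?invr_gt0//.
  by have := ler_normD (x + y) (x - y); lra.
by move: p1 p2; rewrite linearB linearD; lra.
Qed.

(** A finite tensor is taken deep in each slice, all are perturbed by a common [z (x) y0] with [y0]
    of norm 1, and the factor [(1 + d)^-1] brings the result back into the ball. *)
Lemma SSD2P_perturbable (R : realType) (X Y : normedModType R) :
  (exists y : Y, y != 0) ->
  (forall (I J : finType) (A : I -> set (option J -> R)) (B e : R), 0 < e ->
    (forall i a t, A i a -> `|a t| <= B) ->
    (forall i a, A i a -> `|a None| <= 1) -> perturbable X A e) ->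
  SSD2P (inj_tensor X Y).
Proof.
move=> [y1 y1_neq0] pX n S e n0 Sslice e0.
pose y0 := `|y1|^-1 *: y1.
have y0E : `|y0| = 1.
  by rewrite /y0 normrZ normfV normr_id mulVf ?normr_eq0.
have [phi /all_and2[phi1 /choice[al /all_and2[al0 SE]]]] :
    {phi : 'I_n -> dual (inj_tensor X Y) & forall i,
      `|phi i| = 1 /\ exists a, 0 < a /\ S i = slice (phi i) a}.
  apply: (@choice _ _ (fun i phi =>
    `|phi| = 1 /\ exists a, 0 < a /\ S i = slice phi a)) => i.
  by have [p [a [p1 a0 ->]]] := Sslice i; exists p; split=> //; exists a.
(* The losses are [3 * d] for the tensor, [d] for its change, [d] for the perturbation, and the
   rescaling: less than [8 * d] in all. *)
pose d := Num.min (e / 8) (\big[Num.min/1]_i (al i / 8)).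
have d0 : 0 < d.
  rewrite lt_min divr_gt0//=; apply: lt_bigmin => // i _.
  by rewrite divr_gt0.
have de : 8 * d <= e.
  by have : d <= e / 8; [rewrite ge_min lexx|lra].
have dal i : 8 * d <= al i.
  have : d <= al i / 8; last lra.
  by rewrite ge_min; apply/orP; right; exact: bigmin_le.
have /choice[s /all_and2[s1 sphi]] := fun i => slice_elem (phi1 i) d0.
pose m := \max_i size (s i).
pose u i := \sum_(z <- s i) elem z.1 z.2.
pose x i (j : 'I_m) := (nth (0, 0) (s i) j).1.
pose y i (t : option 'I_m) :=
  if t is Some j then (nth (0, 0) (s i) j).2 else y0.
have uE i : u i = \sum_j elem (x i j) (y i (Some j)).
  apply: (@big_nth_pad _ _ (0, 0) (s i) m (fun z => elem z.1 z.2)).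
    exact: elem0.
  exact: leq_bigmax.
(* This choice makes [tensor_ball (A i)] the unit ball of the tensors over [y i], with [None]
   reserved for [y0]. *)
pose A i : set (option 'I_m -> R) :=
  [set a | exists2 q : dual Y, `|q| <= 1 & a = fun t => q (y i t)].
pose B := \sum_i \sum_t `|y i t|.
have AB i a t : A i a -> `|a t| <= B.
  move=> [q q1 ->]; apply: le_trans (blin_norm_le _ _) _.
  apply: (@le_trans _ _ `|y i t|); first by rewrite ler_piMl.
  rewrite /B (bigD1 i)//= (bigD1 t)//= -addrA lerDl addr_ge0 ?sumr_ge0//.
  by move=> k _; exact: sumr_ge0.
have A1 i a : A i a -> `|a None| <= 1.
  move=> [q q1 ->]; apply: le_trans (blin_norm_le _ _) _.
  by rewrite y0E mulr1.
have gP i t : (fun z : X => phi i (elem z (y i t)) : R^o) \in @is_blin R X R^o.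
  apply: (@is_blin_bounded _ _ _ _ `|y i t|) => [a z w|z].
    by rewrite elem_linear linearP.
  apply: le_trans (blin_norm_le _ _) _.
  by rewrite phi1 mul1r mulrC elem_norm_le.
pose g i t : dual X := Blin (gP i t).
have gA i : tensor_polar (A i) (g i).
  move=> w wA.
  have -> : \sum_t (g i t (w t) : R) = phi i (\sum_t elem (w t) (y i t)) :> R.
    by rewrite linear_sum.
  apply: le_trans (ler_norm _) _; apply: le_trans (blin_norm_le _ _) _.
  rewrite phi1 mul1r; apply: sum_elem_norm_le => q q1.
  by apply: wA; exists q.
have xA i a : A i a -> `|\sum_j a (Some j) *: x i j| <= 1.
  move=> [q q1 ->]; apply: le_trans (s1 i); rewrite -/(u i) uE.
  exact: (sum_elem_norm_ge (x i) (fun j => y i (Some j)) q1).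
have d20 : 0 < d / 2 by rewrite divr_gt0.
have [|x' [z [xz1 gx gz z1]]] := pX _ _ A B (d / 2) d20 AB A1 g x gA xA d.
  lra.
pose u' i := \sum_j elem (x' i j) (y i (Some j)).
pose v := elem z y0.
pose c := (1 + d)^-1.
have d1 : 0 < 1 + d by lra.
have c0 : 0 < c by rewrite invr_gt0.
have vs (b : bool) : (-1) ^+ b *: v = elem ((-1) ^+ b *: z) y0.
  by rewrite elemZ.
have Sb i (b : bool) : S i (c *: (u' i + (-1) ^+ b *: v)).
  rewrite SE; split.
    rewrite /unit_ball/= normrZ gtr0_norm// ler_pdivrMl// mulr1.
    pose w (t : option 'I_m) := if t is Some j then x' i j else (-1) ^+ b *: z.
    have -> : u' i + (-1) ^+ b *: v = \sum_t elem (w t) (y i t).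
      by rewrite big_option addrC vs.
    apply: sum_elem_norm_le => q q1; rewrite big_option addrC /=.
    rewrite scalerA mulrC -scalerA.
    by apply: (xz1 i (fun t => q (y i t)) b); exists q.
  have -> : phi i (c *: (u' i + (-1) ^+ b *: v)) =
      c * (phi i (u' i) + (-1) ^+ b * phi i v) :> R.
    by rewrite linearZ linearD linearZ.
  have h1 : phi i (u i) - d <= phi i (u' i) :> R.
    by move: (gx i); rewrite uE /u' !linear_sum.
  have h2 : - d <= (-1) ^+ b * phi i v.
    have : `|(-1) ^+ b * phi i v| <= d.
      by rewrite normrM normrX normrN1 expr1n mul1r; exact: gz.
    by rewrite ler_norml => /andP[].
  have := sphi i; rewrite -/(u i) => h3; have := dal i.
  rewrite ltr_pdivlMl//.
  have : 0 <= d * d by rewrite mulr_ge0 // ltW.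
  nra.
have Sp i : S i (c *: u' i + c *: v) /\ S i (c *: u' i - c *: v).
  have := Sb i false; have := Sb i true.
  by rewrite expr0 expr1 !scalerDr scale1r scaleN1r scalerN.
exists (fun i => c *: u' i), (c *: v); split=> // [i||].
- by have [h1 h2] := Sp i; exact: slice_average (Sslice i) h1 h2.
- have [] := Sp (Ordinal n0); rewrite SE => -[b1 _] [b2 _].
  rewrite /unit_ball/= in b1 b2 *; set w := c *: u' _ in b1 b2.
  have -> : c *: v = 2^-1 *: ((w + c *: v) - (w - c *: v)).
    rewrite opprD opprK addrACA subrr add0r -mulr2n -[c *: v *+ 2]scaler_nat.
    by rewrite scalerA mulVf// scale1r.
  rewrite normrZ gtr0_norm ?invr_gt0//.
  by have := ler_normB (w + c *: v) (w - c *: v); lra.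
rewrite normrZ gtr0_norm// ltr_pdivlMl//.
apply: lt_le_trans (le_trans z1 (elem_norm_ge _ y0E)).
have : 0 <= d * d by rewrite mulr_ge0 // ltW.
nra.
Qed.

Theorem theorem3p1 (R : realType) (X Y : completeNormedModType R)
    (X_nontrivial : exists x : X, x != 0)
    (Y_nontrivial : exists y : Y, y != 0)
    (supZ : ereal_sup [set dimension (centralizer (even_dual X n)) |
                        n in [set: nat]] = +oo%E) :
  SSD2P (inj_tensor X Y).
Proof.
apply: SSD2P_perturbable Y_nontrivial _ => I J A B e e0 AB A1.
(* The number of multipliers is to exceed [4 * #|I| / e]; the successor also makes it positive. *)
have [n [m [T [Nm mT liT]]]] :=
  even_dual_multipliers supZ (Num.truncn (4 * #|I|%:R / e)).+1.
apply: (perturbable_even_dual (n := n) (ltW e0) AB).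
apply: (perturbable_multiplier mT liT) => //; [exact: leq_trans Nm|exact: ltW|].
rewrite -ler_pdivrMl// mulrC; apply: ltW.
have : 0 <= 4 * #|I|%:R / e by rewrite divr_ge0// ltW.
move=> /truncn_itv/andP[_ /lt_le_trans]; apply.
by rewrite ler_nat.
Qed.
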